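(* Let $(\mathbb X,\mathbb T)$ be a tangentad in a 2-category $\mathbf K$. Suppose that the inserter $\mathbb I:\mathrm{id}_{\mathbb X}\Rightarrow T$ of $\mathrm{id}_{\mathbb X}$ and $T$, with universal 1-morphism $V:\mathbb I\to\mathbb X$ and universal 2-morphism $\hat\theta:V\Rightarrow T\circ V$, and the equifier $\mathbb E$ of the two 2-morphisms $p_V\circ\hat\theta,\ \mathrm{id}_V:V\Rightarrow V$ exist in $\mathbf K$. Then $(\mathbb X,\mathbb T)$ admits the construction of vector fields in $\mathbf K$, and the tangentad $\mathrm{VF}(\mathbb X,\mathbb T)$ of vector fields of $(\mathbb X,\mathbb T)$ is the equifier $(\mathbb E,\mathbb T^{\mathbb E})$, where $\mathbb T^{\mathbb E}$ is the tangent structure induced on the equifier.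
   Context: Let $\mathbf K$ be a 2-category. For a 2-morphism $\varphi$ and a 1-morphism $H$, write $H\varphi$ and $\varphi_H$ for the whiskerings (post- and precomposition with $H$). A pullback in $\mathbf K(\mathbb X,\mathbb Y)$ is pointwise if it is preserved by $\mathbf K(F,\mathbb Y)$ for every 1-morphism $F:\mathbb X'\to\mathbb X$. Tangentad: a tangentad $(\mathbb X,\mathbb T)$ in $\mathbf K$ is an object $\mathbb X$ with a tangent structure $\mathbb T=(T,p,z,s,l,c)$: a 1-morphism $T:\mathbb X\to\mathbb X$ and 2-morphisms $p:T\Rightarrow\mathrm{id}$, $z:\mathrm{id}\Rightarrow T$, $s:T_2\Rightarrow T$, $l:T\Rightarrow T^2$, $c:T^2\Rightarrow T^2$ such that: (1) for each $n\ge1$ the $n$-fold pullback $T_n$ of $p$ along itself (projections $\pi_k:T_n\Rightarrow T$) exists in $\mathbf K(\mathbb X,\mathbb X)$, is pointwise, and is preserved by postcomposition with all iterates $T^m$; (2) $pz=\mathrm{id}$, $ps=p\pi_1$, and $s$ is associative, commutative and unital with unit $z$; (3) $Tp\circ l=z\circ p$, $l\circ z=Tz\circ z$, $l\circ s=Ts\circ\langle l\pi_1,l\pi_2\rangle$; (4) $p_T\circ c=Tp$, $c\circ Tz=z_T$, $c\circ Ts=s_T\circ\langle c\circ T\pi_1,c\circ T\pi_2\rangle$; (5) $Tl\circ l=l_T\circ l$, $c\circ l=l$, $c_T\circ Tc\circ l_T=Tl\circ c$, $c\circ c=\mathrm{id}$, $Tc\circ c_T\circ Tc=c_T\circ Tc\circ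 c_T$; (6) the square with top $Ts\circ\langle l\pi_1,z_T\pi_2\rangle:T_2\Rightarrow T^2$, left side $p\pi_1:T_2\Rightarrow\mathrm{id}$, right side $Tp:T^2\Rightarrow T$ and bottom $z:\mathrm{id}\Rightarrow T$ is a pointwise pullback. A tangent category is a tangentad in the 2-category $\mathsf{Cat}$. Morphisms: a lax tangent morphism $(F,\alpha):(\mathbb X,\mathbb T)\to(\mathbb X',\mathbb T')$ is a 1-morphism $F:\mathbb X\to\mathbb X'$ with a 2-morphism $\alpha:F\circ T\Rightarrow T'\circ F$ such that $p'_F\circ\alpha=Fp$, $\alpha\circ Fz=z'_F$, $\alpha\circ Fs=s'_F\circ\langle\alpha\circ F\pi_1,\alpha\circ F\pi_2\rangle$, $l'_F\circ\alpha=T'\alpha\circ\alpha_T\circ Fl$, $c'_F\circ T'\alpha\circ\alpha_T=T'\alpha\circ\alpha_T\circ Fc$. It is strong if $\alpha$ is invertible, strict if $\alpha$ is an identity. A tangent 2-morphism $\varphi:(F,\alpha)\Rightarrow(G,\beta)$ is a 2-morphism $\varphi:F\Rightarrow G$ with $T'\varphi\circ\alpha=\beta\circ\varphi_T$. $\mathsf{Tng}(\mathbf K)$ is the 2-category of tangentads of $\mathbf K$, lax tangent morphisms and tangent 2-morphisms. Hom-tangent category: $[\mathbb X',\mathbb T'\mid\mathbb X,\mathbb T]$ is the category $\mathsf{Tng}(\mathbf K)((\mathbb X',\mathbb T'),(\mathbb X,\mathbb T))$ with the pointwise tangent structure: $\bar T(F,\alpha)=(T,c)\circ(F,\alpha)=(T\circ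 F,c_F\circ T\alpha)$, $\bar T\varphi=T\varphi$, structural transformations $p_F,z_F,s_F,l_F,c_F$. Vector fields: a vector field on an object $M$ of a tangent category is $v:M\to TM$ with $p_M\circ v=\mathrm{id}_M$. For a tangent category $(\mathbb Y,\mathbb T)$, $\mathrm{VF}(\mathbb Y,\mathbb T)$ is the tangent category of pairs $(M,v)$, $v$ a vector field on $M$; morphisms $f:(M,v)\to(N,u)$ are $f:M\to N$ with $Tf\circ v=u\circ f$; tangent bundle functor $(M,v)\mapsto(TM,c_M\circ Tv)$, $f\mapsto Tf$; structural transformations as in $(\mathbb Y,\mathbb T)$. $\mathrm{VF}[\mathbb X',\mathbb T'\mid\mathbb X,\mathbb T]$ is this construction applied to the Hom-tangent category. Construction of vector fields: for a strict tangent morphism $U:(\mathbb V,\mathbb T^{\mathbb V})\to(\mathbb X,\mathbb T)$ and a vector field $\mathbf v:U\Rightarrow\bar TU$ on $U$ in $[\mathbb V,\mathbb T^{\mathbb V}\mid\mathbb X,\mathbb T]$, for each tangentad $(\mathbb X',\mathbb T')$ let $\Gamma_{\mathbf v}:[\mathbb X',\mathbb T'\mid\mathbb V,\mathbb T^{\mathbb V}]\to\mathrm{VF}[\mathbb X',\mathbb T'\mid\mathbb X,\mathbb T]$ be the strict tangent morphism $(H,\gamma)\mapsto(U\circ(H,\gamma),\mathbf v_H)$, $\varphi\mapsto U\varphi$. A tangentad $(\mathbb X,\mathbb T)$ admits the construction of vector fields if there are a tangentad $\mathrm{VF}(\mathbb X,\mathbb T)$ (the tangentad of vector fields), a strict tangent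 morphism $U:\mathrm{VF}(\mathbb X,\mathbb T)\to(\mathbb X,\mathbb T)$ and a vector field $\mathbf v$ on $U$ in $[\mathrm{VF}(\mathbb X,\mathbb T)\mid\mathbb X,\mathbb T]$ (the universal vector field) such that $\Gamma_{\mathbf v}$ is invertible for every $(\mathbb X',\mathbb T')$. Inserter: for $F,G:\mathbb X\to\mathbb X'$ and an object $\mathbb Y$, $\mathsf{Insert}[\mathbb Y;F,G]$ is the category of pairs $(H:\mathbb Y\to\mathbb X,\ \tau:F\circ H\Rightarrow G\circ H)$ with morphisms $(H,\tau)\to(H',\tau')$ the 2-morphisms $\varphi:H\Rightarrow H'$ with $\tau'\circ F\varphi=G\varphi\circ\tau$. An inserter $\mathbb I:F\Rightarrow G$ is an object $\mathbb I$ with $V:\mathbb I\to\mathbb X$ and $\hat\theta:F\circ V\Rightarrow G\circ V$ such that $\mathbf K(\mathbb Y,\mathbb I)\to\mathsf{Insert}[\mathbb Y;F,G]$, $H\mapsto(V\circ H,\hat\theta_H)$, $\psi\mapsto V\psi$, is an isomorphism of categories for every $\mathbb Y$. Equifier: for 2-morphisms $\varphi,\psi:F\Rightarrow G:\mathbb X\to\mathbb X'$, an equifier is an object $\mathbb E$ with $W:\mathbb E\to\mathbb X$ such that $\varphi_W=\psi_W$ and, for every $\mathbb Y$, postcomposition with $W$ is an isomorphism from $\mathbf K(\mathbb Y,\mathbb E)$ to the full subcategory $\mathsf{Equif}[\mathbb Y;\varphi,\psi]$ of $\mathbf K(\mathbb Y,\mathbb X)$ on those $H$ with $\varphi_H=\psi_H$.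 Induced tangent structures: $\mathbb I$ carries the tangent structure $\mathbb T^{\mathbb I}$ corresponding, via $\mathbf K(-,\mathbb I)\cong\mathsf{Insert}[-;\mathrm{id},T]$, to $(H,\tau)\mapsto(T\circ H,\ c_H\circ T\tau)$ with structural transformations those of $\mathbb T$; it makes $V$ strict. $\mathbb E$ carries the tangent structure $\mathbb T^{\mathbb E}$ corresponding, via $\mathbf K(-,\mathbb E)\cong\mathsf{Equif}$, to $H\mapsto T^{\mathbb I}\circ H$ with structural transformations those of $\mathbb T^{\mathbb I}$; it makes $W:\mathbb E\to\mathbb I$ strict. *)

(* Defs.v *)
From mathcomp Require Import ssreflect ssrfun ssrbool eqtype ssrnat.
From Stdlib Require Import ClassicalEpsilon ProofIrrelevance.

Set Implicit Arguments.
Unset Strict Implicit.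
Unset Printing Implicit Defensive.

Declare Scope cell_scope.
Delimit Scope cell_scope with cell.
Reserved Notation "G ∘ F" (at level 40, left associativity).
Reserved Notation "H ◁ a" (at level 40, left associativity).
Reserved Notation "a ▷ F" (at level 40, left associativity).
Reserved Notation "b • a" (at level 50, left associativity).

(** * Strict 2-categories

    The 2-cells between two objects form one type, with source and target
    maps, instead of a family indexed by parallel 1-morphisms.  The strict laws
    of a 2-category ([F ∘ (G ∘ H) = (F ∘ G) ∘ H], and so on) are then plain
    equations, with no transport between types of 2-cells.  The price is that
    [vcomp] is total: [vcomp b a] is the vertical composite when
    [tgt a = src b], and is unspecified otherwise.  [whl H a] and [whr a H]
    are the whiskerings usually written [H a] and [a_H]. *)

Record two_category := TwoCategory {
  obj :> Type;
  mor : obj -> obj -> Type;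
  cell : obj -> obj -> Type;
  src : forall X Y, cell X Y -> mor X Y;
  tgt : forall X Y, cell X Y -> mor X Y;
  id1 : forall X, mor X X;
  comp1 : forall X Y Z, mor Y Z -> mor X Y -> mor X Z;
  id2 : forall X Y, mor X Y -> cell X Y;
  vcomp : forall X Y, cell X Y -> cell X Y -> cell X Y;
  whl : forall X Y Z, mor Y Z -> cell X Y -> cell X Z;
  whr : forall X Y Z, cell Y Z -> mor X Y -> cell X Z;

  comp1A : forall X Y Z W (H : mor Z W) (G : mor Y Z) (F : mor X Y),
    comp1 (comp1 H G) F = comp1 H (comp1 G F);
  comp1id : forall X Y (F : mor X Y), comp1 F (id1 X) = F;
  id1comp : forall X Y (F : mor X Y), comp1 (id1 Y) F = F;

  src_id2 : forall X Y (F : mor X Y), src (id2 F) = F;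
  tgt_id2 : forall X Y (F : mor X Y), tgt (id2 F) = F;
  src_vcomp : forall X Y (b a : cell X Y), tgt a = src b ->
    src (vcomp b a) = src a;
  tgt_vcomp : forall X Y (b a : cell X Y), tgt a = src b ->
    tgt (vcomp b a) = tgt b;
  src_whl : forall X Y Z (H : mor Y Z) (a : cell X Y),
    src (whl H a) = comp1 H (src a);
  tgt_whl : forall X Y Z (H : mor Y Z) (a : cell X Y),
    tgt (whl H a) = comp1 H (tgt a);
  src_whr : forall X Y Z (a : cell Y Z) (H : mor X Y),
    src (whr a H) = comp1 (src a) H;
  tgt_whr : forall X Y Z (a : cell Y Z) (H : mor X Y),
    tgt (whr a H) = comp1 (tgt a) H;

  vcompA : forall X Y (d b a : cell X Y), tgt a = src b -> tgt b = src d ->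
    vcomp (vcomp d b) a = vcomp d (vcomp b a);
  vcompid : forall X Y (a : cell X Y), vcomp a (id2 (src a)) = a;
  idvcomp : forall X Y (a : cell X Y), vcomp (id2 (tgt a)) a = a;

  whl_id2 : forall X Y Z (H : mor Y Z) (F : mor X Y),
    whl H (id2 F) = id2 (comp1 H F);
  whr_id2 : forall X Y Z (G : mor Y Z) (F : mor X Y),
    whr (id2 G) F = id2 (comp1 G F);
  whl_vcomp : forall X Y Z (H : mor Y Z) (b a : cell X Y), tgt a = src b ->
    whl H (vcomp b a) = vcomp (whl H b) (whl H a);
  whr_vcomp : forall X Y Z (b a : cell Y Z) (H : mor X Y), tgt a = src b ->
    whr (vcomp b a) H = vcomp (whr b H) (whr a H);
  whl_id1 : forall X Y (a : cell X Y), whl (id1 Y) a = a;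
  whr_id1 : forall X Y (a : cell X Y), whr a (id1 X) = a;
  whl_comp1 : forall X Y Z W (H : mor Z W) (G : mor Y Z) (a : cell X Y),
    whl (comp1 H G) a = whl H (whl G a);
  whr_comp1 : forall X Y Z W (a : cell Z W) (G : mor Y Z) (F : mor X Y),
    whr a (comp1 G F) = whr (whr a G) F;
  whlr : forall X Y Z W (H : mor Z W) (a : cell Y Z) (F : mor X Y),
    whr (whl H a) F = whl H (whr a F);
  interchange : forall X Y Z (b : cell Y Z) (a : cell X Y),
    vcomp (whr b (tgt a)) (whl (src b) a) = vcomp (whl (tgt b) a) (whr b (src a))
}.

Arguments mor {t} _ _.
Arguments cell {t} _ _.
Arguments src {t X Y}.
Arguments tgt {t X Y}.
Arguments id1 {t} X.
Arguments comp1 {t X Y Z}.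
Arguments id2 {t X Y}.
Arguments vcomp {t X Y}.
Arguments whl {t X Y Z}.
Arguments whr {t X Y Z}.

Notation "G ∘ F" := (comp1 G F) : cell_scope.
Notation "b • a" := (vcomp b a) : cell_scope.
Notation "H ◁ a" := (whl H a) : cell_scope.
Notation "a ▷ F" := (whr a F) : cell_scope.
Local Open Scope cell_scope.

Definition from_to (K : two_category) (X Y : K) (F G : mor X Y) (a : cell X Y) :=
  src a = F /\ tgt a = G.

Fixpoint iter1 (K : two_category) (X : K) (T : mor X X) (m : nat) : mor X X :=
  if m is m'.+1 then T ∘ iter1 T m' else id1 X.

(** * Pullbacks in the hom-categories *)

(* [P] with projections [pi k], [k < n], is the [n]-fold pullback of [p] along
   itself. *)
Definition is_fibre_power (K : two_category) (X Y : K) (n : nat) (p : cell X Y)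
    (P : mor X Y) (pi : nat -> cell X Y) : Prop :=
  [/\ forall k, k < n -> from_to P (src p) (pi k),
      forall j k, j < n -> k < n -> p • pi j = p • pi k
    & forall (A : mor X Y) (f : nat -> cell X Y),
        (forall k, k < n -> from_to A (src p) (f k)) ->
        (forall j k, j < n -> k < n -> p • f j = p • f k) ->
        exists! u, from_to A P u /\ forall k, k < n -> pi k • u = f k].

Definition is_pointwise_fibre_power (K : two_category) (X Y : K) (n : nat)
    (p : cell X Y) (P : mor X Y) (pi : nat -> cell X Y) : Prop :=
  is_fibre_power n p P pi /\
  forall (X' : K) (F : mor X' X),
    is_fibre_power n (p ▷ F) (P ∘ F) (fun k => pi k ▷ F).

(*        top
      P -----> A
 left |        | right
      B -----> C
        bot           *)
Definition is_pullback (K : two_category) (X Y : K) (P A B C : mor X Y)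
    (top left right bot : cell X Y) : Prop :=
  [/\ from_to P A top, from_to P B left, from_to A C right & from_to B C bot] /\
  right • top = bot • left /\
  forall (D : mor X Y) (a b : cell X Y), from_to D A a -> from_to D B b ->
    right • a = bot • b ->
    exists! u, from_to D P u /\ top • u = a /\ left • u = b.

Definition is_pointwise_pullback (K : two_category) (X Y : K)
    (P A B C : mor X Y) (top left right bot : cell X Y) : Prop :=
  is_pullback P A B C top left right bot /\
  forall (X' : K) (F : mor X' X),
    is_pullback (P ∘ F) (A ∘ F) (B ∘ F) (C ∘ F)
      (top ▷ F) (left ▷ F) (right ▷ F) (bot ▷ F).

(* [<a, b>] with respect to the projections [q0] and [q1]; it is the mediating
   2-cell when [q0] and [q1] are the projections of a pullback and [a], [b]
   form a cone, and is unspecified otherwise. *)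
Definition pairing (K : two_category) (X Y : K) (q0 q1 a b : cell X Y) :
    cell X Y :=
  epsilon (inhabits a) (fun u => from_to (src a) (src q0) u /\
                                 q0 • u = a /\ q1 • u = b).

(** * Tangentads *)

(* [Tn n] and [pi n k], [k < n], are a choice of the n-fold pullback of [p] and
   of its projections; they are constrained for [n >= 1] only. *)
Record tangent_structure (K : two_category) (X : K) := TangentStructure {
  tT : mor X X;
  tTn : nat -> mor X X;
  tpi : nat -> nat -> cell X X;
  tp : cell X X;
  tz : cell X X;
  ts : cell X X;
  tl : cell X X;
  tc : cell X X;

  tp_ft : from_to tT (id1 X) tp;
  tz_ft : from_to (id1 X) tT tz;
  ts_ft : from_to (tTn 2) tT ts;
  tl_ft : from_to tT (tT ∘ tT) tl;
  tc_ft : from_to (tT ∘ tT) (tT ∘ tT) tc;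

  tTn_pointwise : forall n, 0 < n ->
    is_pointwise_fibre_power n tp (tTn n) (tpi n);
  (* each pullback [tTn n ∘ F] of the pointwise pullback [tTn n] is preserved
     by postcomposition with the iterates of [tT] *)
  tTn_preserved : forall n m, 0 < n ->
    is_pointwise_fibre_power n (iter1 tT m ◁ tp) (iter1 tT m ∘ tTn n)
      (fun k => iter1 tT m ◁ tpi n k);

  tpz : tp • tz = id2 (id1 X);
  tps : tp • ts = tp • tpi 2 0;
  tsA : ts • pairing (tpi 2 0) (tpi 2 1)
               (ts • pairing (tpi 2 0) (tpi 2 1) (tpi 3 0) (tpi 3 1)) (tpi 3 2)
      = ts • pairing (tpi 2 0) (tpi 2 1)
               (tpi 3 0) (ts • pairing (tpi 2 0) (tpi 2 1) (tpi 3 1) (tpi 3 2));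
  tsC : ts • pairing (tpi 2 0) (tpi 2 1) (tpi 2 1) (tpi 2 0) = ts;
  tzs : ts • pairing (tpi 2 0) (tpi 2 1) (tz • tp) (id2 tT) = id2 tT;

  tpl : (tT ◁ tp) • tl = tz • tp;
  tlz : tl • tz = (tT ◁ tz) • tz;
  tls : tl • ts = (tT ◁ ts) • pairing (tT ◁ tpi 2 0) (tT ◁ tpi 2 1)
                                (tl • tpi 2 0) (tl • tpi 2 1);

  tpc : (tp ▷ tT) • tc = tT ◁ tp;
  tcz : tc • (tT ◁ tz) = tz ▷ tT;
  tcs : tc • (tT ◁ ts) = (ts ▷ tT) • pairing (tpi 2 0 ▷ tT) (tpi 2 1 ▷ tT)
                                (tc • (tT ◁ tpi 2 0)) (tc • (tT ◁ tpi 2 1));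

  tll : (tT ◁ tl) • tl = (tl ▷ tT) • tl;
  tcl : tc • tl = tl;
  tccl : (tc ▷ tT) • (tT ◁ tc) • (tl ▷ tT) = (tT ◁ tl) • tc;
  tcc : tc • tc = id2 (tT ∘ tT);
  tYB : (tT ◁ tc) • (tc ▷ tT) • (tT ◁ tc) = (tc ▷ tT) • (tT ◁ tc) • (tc ▷ tT);

  tlift : is_pointwise_pullback (tTn 2) (tT ∘ tT) (id1 X) tT
    ((tT ◁ ts) • pairing (tT ◁ tpi 2 0) (tT ◁ tpi 2 1)
                   (tl • tpi 2 0) ((tz ▷ tT) • tpi 2 1))
    (tp • tpi 2 0) (tT ◁ tp) tz
}.

Record tangentad (K : two_category) := Tangentad {
  tobj :> obj K;
  tstr :> tangent_structure tobj
}.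

Definition is_lax_tangent (K : two_category) (A B : tangentad K)
    (F : mor A B) (al : cell A B) : Prop :=
  from_to (F ∘ tT A) (tT B ∘ F) al /\
  [/\ (tp B ▷ F) • al = F ◁ tp A,
      al • (F ◁ tz A) = tz B ▷ F,
      al • (F ◁ ts A) = (ts B ▷ F) • pairing (tpi B 2 0 ▷ F) (tpi B 2 1 ▷ F)
                          (al • (F ◁ tpi A 2 0)) (al • (F ◁ tpi A 2 1)),
      (tl B ▷ F) • al = (tT B ◁ al) • (al ▷ tT A) • (F ◁ tl A)
    & (tc B ▷ F) • (tT B ◁ al) • (al ▷ tT A) =
        (tT B ◁ al) • (al ▷ tT A) • (F ◁ tc A)].

Record lax_tangent (K : two_category) (A B : tangentad K) := LaxTangent {
  lmor :> mor A B;
  lcell : cell A B;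
  lax_ok : is_lax_tangent lmor lcell
}.

Definition is_strict (K : two_category) (A B : tangentad K)
    (F : lax_tangent A B) : Prop :=
  F ∘ tT A = tT B ∘ F /\ lcell F = id2 (F ∘ tT A).

Definition is_tangent_cell (K : two_category) (A B : tangentad K)
    (F G : lax_tangent A B) (a : cell A B) : Prop :=
  from_to F G a /\ (tT B ◁ a) • lcell F = lcell G • (a ▷ tT A).

(** * Categories and functors *)

Record category := Category {
  ob :> Type;
  hom : ob -> ob -> Type;
  idc : forall A, hom A A;
  compc : forall A B C, hom B C -> hom A B -> hom A C;
  compcA : forall A B C D (h : hom C D) (g : hom B C) (f : hom A B),
    compc (compc h g) f = compc h (compc g f);
  compc_id : forall A B (f : hom A B), compc f (idc A) = f;
  idc_comp : forall A B (f : hom A B), compc (idc B) f = f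
}.
Arguments hom {c} _ _.
Arguments idc {c} A.
Arguments compc {c A B C}.

Record functor (C D : category) := Functor {
  fob :> C -> D;
  fhom : forall A B : C, hom A B -> hom (fob A) (fob B);
  fhom_id : forall A, fhom (idc A) = idc (fob A);
  fhom_comp : forall A B C (g : hom B C) (f : hom A B),
    fhom (compc g f) = compc (fhom g) (fhom f)
}.
Arguments fhom {C D} _ {A B} _.

Definition is_cat_iso (C D : category) (F : functor C D) : Prop :=
  bijective F /\ forall A B : C, bijective (@fhom C D F A B).

Lemma sig_eq (T : Type) (P : T -> Prop) (x y : {t | P t}) :
  sval x = sval y -> x = y.
Proof.
case: x y => [x px] [y py] /= e; case: _ / e py => py.
by rewrite (proof_irrelevance _ px py).
Qed.

(** * Calculus of 2-cells *)

Lemma tp_src (K : two_category) (X : K) (t : tangent_structure X) : src (tp t) = tT t.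
Proof. by case: (tp_ft t). Qed.
Lemma tp_tgt (K : two_category) (X : K) (t : tangent_structure X) : tgt (tp t) = id1 X.
Proof. by case: (tp_ft t). Qed.
Lemma tz_src (K : two_category) (X : K) (t : tangent_structure X) : src (tz t) = id1 X.
Proof. by case: (tz_ft t). Qed.
Lemma tz_tgt (K : two_category) (X : K) (t : tangent_structure X) : tgt (tz t) = tT t.
Proof. by case: (tz_ft t). Qed.
Lemma ts_src (K : two_category) (X : K) (t : tangent_structure X) : src (ts t) = tTn t 2.
Proof. by case: (ts_ft t). Qed.
Lemma ts_tgt (K : two_category) (X : K) (t : tangent_structure X) : tgt (ts t) = tT t.
Proof. by case: (ts_ft t). Qed.
Lemma tl_src (K : two_category) (X : K) (t : tangent_structure X) : src (tl t) = tT t.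
Proof. by case: (tl_ft t). Qed.
Lemma tl_tgt (K : two_category) (X : K) (t : tangent_structure X) :
  tgt (tl t) = tT t ∘ tT t.
Proof. by case: (tl_ft t). Qed.
Lemma tc_src (K : two_category) (X : K) (t : tangent_structure X) :
  src (tc t) = tT t ∘ tT t.
Proof. by case: (tc_ft t). Qed.
Lemma tc_tgt (K : two_category) (X : K) (t : tangent_structure X) :
  tgt (tc t) = tT t ∘ tT t.
Proof. by case: (tc_ft t). Qed.
Lemma tpi_ft (K : two_category) (X : K) (t : tangent_structure X) n k :
  k < n -> from_to (tTn t n) (tT t) (tpi t n k).
Proof.
move=> kn; have n0 : 0 < n by apply: leq_ltn_trans kn.
by case: (tTn_pointwise t n0) => [[/(_ k kn)]]; rewrite tp_src.
Qed.
Lemma tpi_src (K : two_category) (X : K) (t : tangent_structure X) n k :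
  k < n -> src (tpi t n k) = tTn t n.
Proof. by case/(tpi_ft t). Qed.
Lemma tpi_tgt (K : two_category) (X : K) (t : tangent_structure X) n k :
  k < n -> tgt (tpi t n k) = tT t.
Proof. by case/(tpi_ft t). Qed.
Lemma lcell_src (K : two_category) (A B : tangentad K) (F : lax_tangent A B) :
  src (lcell F) = F ∘ tT A.
Proof. by case: (lax_ok F) => [[]]. Qed.
Lemma lcell_tgt (K : two_category) (A B : tangentad K) (F : lax_tangent A B) :
  tgt (lcell F) = tT B ∘ F.
Proof. by case: (lax_ok F) => [[]]. Qed.

Definition stE := (src_id2, tgt_id2, src_whl, tgt_whl, src_whr, tgt_whr,
  tp_src, tp_tgt, tz_src, tz_tgt, ts_src, ts_tgt, tl_src, tl_tgt, tc_src,
  tc_tgt, lcell_src, lcell_tgt, comp1A, comp1id, id1comp).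

(* proves equations between sources and targets of pasted 2-cells *)
Ltac ty :=
  try (split; ty);
  repeat first
    [ progress rewrite ?stE
    | rewrite src_vcomp; [|solve [ty]]
    | rewrite tgt_vcomp; [|solve [ty]]
    | rewrite tpi_src; [|by []]
    | rewrite tpi_tgt; [|by []]
    | match goal with
      | H : src ?a = _ |- context [src ?a] => rewrite H
      | H : tgt ?a = _ |- context [tgt ?a] => rewrite H
      end ];
  reflexivity.
#[local] Hint Extern 0 (tgt _ = src _) => ty : core.
#[local] Hint Extern 0 (src _ = _) => ty : core.
#[local] Hint Extern 0 (tgt _ = _) => ty : core.
#[local] Hint Extern 0 (from_to _ _ _) => ty : core.

Lemma pairing_unique (K : two_category) (X Y : K) (p q0 q1 a b u : cell X Y)
    (P : mor X Y) (pi : nat -> cell X Y) :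
  is_fibre_power 2 p P pi -> pi 0 = q0 -> pi 1 = q1 ->
  from_to (src a) P u -> from_to (src a) (src p) a -> from_to (src a) (src p) b ->
  p • a = p • b -> q0 • u = a -> q1 • u = b -> pairing q0 q1 a b = u.
Proof.
case=> piP _ univ <- <- uP aP bP pab u0 u1.
have sq : src (pi 0) = P by case: (piP 0 isT).
have [||v [_ vU]] := univ (src a) (fun k => if k is 0 then a else b).
- by case=> [|[|]].
- by case=> [|[|?]] [|[|?]].
pose Q w := from_to (src a) (src (pi 0)) w /\ pi 0 • w = a /\ pi 1 • w = b.
have Qu : Q u by split=> //; rewrite sq.
have [Q1 [Q2 Q3]] : Q (pairing (pi 0) (pi 1) a b).
  by apply: (epsilon_spec (inhabits a) Q); exists u.
rewrite sq in Q1.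
by rewrite -(vU u) ?(vU (pairing (pi 0) (pi 1) a b)) //; split=> //;
  case=> [|[|]].
Qed.

Lemma pairing_spec (K : two_category) (X Y : K) (p q0 q1 a b : cell X Y)
    (P : mor X Y) (pi : nat -> cell X Y) :
  is_fibre_power 2 p P pi -> pi 0 = q0 -> pi 1 = q1 ->
  from_to (src a) (src p) a -> from_to (src a) (src p) b ->
  p • a = p • b ->
  [/\ from_to (src a) P (pairing q0 q1 a b),
      q0 • pairing q0 q1 a b = a & q1 • pairing q0 q1 a b = b].
Proof.
move=> pb e0 e1 aP bP pab; have [_ _ univ] := pb.
have [||v [[vP ve] _]] := univ (src a) (fun k => if k is 0 then a else b).
- by case=> [|[|]].
- by case=> [|[|?]] [|[|?]].
have v0 := ve 0 isT; have v1 := ve 1 isT; rewrite /= in v0 v1.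
by rewrite (pairing_unique pb e0 e1 vP aP bP pab) -?e0 -?e1.
Qed.

(** * Lax tangent morphisms compose; the hom-tangent category *)

Section Tng.
Variable K : two_category.
Implicit Types A B C : tangentad K.

Lemma tT2 A (X' : K) (F : mor X' A) :
  is_fibre_power 2 (tp A ▷ F) (tTn A 2 ∘ F) (fun k => tpi A 2 k ▷ F).
Proof. by case: (tTn_pointwise A (isT : 0 < 2)) => _ /(_ X' F). Qed.

Lemma tp_pi A : tp A • tpi A 2 0 = tp A • tpi A 2 1.
Proof. by case: (tTn_pointwise A (isT : 0 < 2)) => [[_ e _] _]; apply: e. Qed.

Lemma lax_p A B (F : lax_tangent A B) : (tp B ▷ F) • lcell F = F ◁ tp A.
Proof. by case: (lax_ok F) => _ []. Qed.
Lemma lax_z A B (F : lax_tangent A B) : lcell F • (F ◁ tz A) = tz B ▷ F.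
Proof. by case: (lax_ok F) => _ []. Qed.
Lemma lax_s A B (F : lax_tangent A B) :
  lcell F • (F ◁ ts A) = (ts B ▷ F) • pairing (tpi B 2 0 ▷ F) (tpi B 2 1 ▷ F)
    (lcell F • (F ◁ tpi A 2 0)) (lcell F • (F ◁ tpi A 2 1)).
Proof. by case: (lax_ok F) => _ []. Qed.
Lemma lax_l A B (F : lax_tangent A B) : (tl B ▷ F) • lcell F =
  (tT B ◁ lcell F) • (lcell F ▷ tT A) • (F ◁ tl A).
Proof. by case: (lax_ok F) => _ []. Qed.
Lemma lax_c A B (F : lax_tangent A B) :
  (tc B ▷ F) • (tT B ◁ lcell F) • (lcell F ▷ tT A) =
  (tT B ◁ lcell F) • (lcell F ▷ tT A) • (F ◁ tc A).
Proof. by case: (lax_ok F) => _ []. Qed.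

Lemma lax_c' A B (F : lax_tangent A B) :
  (tc B ▷ F) • ((tT B ◁ lcell F) • (lcell F ▷ tT A)) =
  (tT B ◁ lcell F) • (lcell F ▷ tT A) • (F ◁ tc A).
Proof. by rewrite -lax_c vcompA. Qed.

Lemma whlV (X Y Z : K) (H : mor Y Z) (b a d : cell X Y) : tgt a = src b ->
  b • a = d -> (H ◁ b) • (H ◁ a) = H ◁ d.
Proof. by move=> e <-; rewrite whl_vcomp. Qed.
Lemma whrV (X Y Z : K) (H : mor X Y) (b a d : cell Y Z) : tgt a = src b ->
  b • a = d -> (b ▷ H) • (a ▷ H) = d ▷ H.
Proof. by move=> e <-; rewrite whr_vcomp. Qed.

Arguments whlV {X Y Z H b a d}.
Arguments whrV {X Y Z H b a d}.

(* the interchange law for a 2-cell with a whiskered 1-cell on each side *)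
Lemma xchg (X Y Z : K) (b : cell Y Z) (a : cell X Y) G H F F' :
  from_to G H b -> from_to F F' a ->
  (b ▷ F') • (G ◁ a) = (H ◁ a) • (b ▷ F).
Proof. by case=> <- <- [<- <-]; apply: interchange. Qed.

Lemma lax_pair_spec A B (F : lax_tangent A B) :
  let u := pairing (tpi B 2 0 ▷ F) (tpi B 2 1 ▷ F)
    (lcell F • (F ◁ tpi A 2 0)) (lcell F • (F ◁ tpi A 2 1)) in
  [/\ from_to (F ∘ tTn A 2) (tTn B 2 ∘ F) u,
      (tpi B 2 0 ▷ F) • u = lcell F • (F ◁ tpi A 2 0)
    & (tpi B 2 1 ▷ F) • u = lcell F • (F ◁ tpi A 2 1)].
Proof.
have := @pairing_spec K A B (tp B ▷ F) (tpi B 2 0 ▷ F) (tpi B 2 1 ▷ F)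
  (lcell F • (F ◁ tpi A 2 0)) (lcell F • (F ◁ tpi A 2 1)) _ _ (tT2 F) erefl erefl.
have -> : src (lcell F • (F ◁ tpi A 2 0)) = F ∘ tTn A 2 by ty.
move=> /=; apply=> //.
by rewrite -!vcompA // !lax_p -!whl_vcomp // tp_pi.
Qed.

Lemma lax_two_step A B C (G : lax_tangent B C) (F : lax_tangent A B) :
  (tT C ◁ ((lcell G ▷ F) • (G ◁ lcell F))) •
    (((lcell G ▷ F) • (G ◁ lcell F)) ▷ tT A) =
  (((tT C ◁ lcell G) • (lcell G ▷ tT B)) ▷ F) •
    (G ◁ ((tT B ◁ lcell F) • (lcell F ▷ tT A))).
Proof.
rewrite !whl_vcomp // !whr_vcomp // !vcompA //; congr (_ • _).
  by rewrite whlr.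
rewrite -[LHS]vcompA // -[RHS]vcompA //; congr (_ • _); last by rewrite whlr.
rewrite -!whr_comp1 -!whl_comp1; symmetry.
by apply: xchg.
Qed.

Lemma lax_comp_subproof A B C (G : lax_tangent B C) (F : lax_tangent A B) :
  is_lax_tangent (G ∘ F) ((lcell G ▷ F) • (G ◁ lcell F)).
Proof.
split; first by ty.
split.
- rewrite whr_comp1 -vcompA //.
  by rewrite (whrV _ (lax_p G)) // whlr (whlV _ (lax_p F)) // whl_comp1.
- rewrite whl_comp1 vcompA // (whlV _ (lax_z F)) // -whlr.
  by rewrite (whrV _ (lax_z G)) // whr_comp1.
- rewrite whl_comp1 vcompA // (whlV _ (lax_s F)) //.
  have [ft1 e10 e11] := lax_pair_spec F.
  have [ft2 e20 e21] := lax_pair_spec G.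
  move: e10 e11 e20 e21 (lax_s G) ft1 ft2.
  set u := pairing _ _ _ _; set w := pairing _ _ _ _.
  move=> e10 e11 e20 e21 sG [us ut] [ws wt].
  rewrite whl_vcomp // -whlr -vcompA // (whrV _ sG) // whr_vcomp // vcompA //.
  rewrite -whr_comp1; congr (_ • _); symmetry.
  have aux k : k < 2 -> (tpi C 2 k ▷ G) • w = lcell G • (G ◁ tpi B 2 k) ->
     (tpi B 2 k ▷ F) • u = lcell F • (F ◁ tpi A 2 k) ->
     (tpi C 2 k ▷ (G ∘ F)) • ((w ▷ F) • (G ◁ u)) =
      (lcell G ▷ F) • (G ◁ lcell F) • ((G ∘ F) ◁ tpi A 2 k).
    move=> k2 ew eu; have := tpi_src C k2; have := tpi_tgt C k2.
    have := tpi_src B k2; have := tpi_tgt B k2.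
    have := tpi_src A k2; have := tpi_tgt A k2 => ? ? ? ? ? ?.
    rewrite -vcompA // whr_comp1 (whrV _ ew) // whr_vcomp // vcompA //.
    rewrite whlr (whlV _ eu) // whl_vcomp // -vcompA //.
    by rewrite whl_comp1.
  have sE : src ((lcell G ▷ F) • (G ◁ lcell F) • (G ∘ F ◁ tpi A 2 0))
            = G ∘ F ∘ tTn A 2 by ty.
  apply: (pairing_unique (tT2 (G ∘ F)) erefl erefl); rewrite ?sE //.
  + rewrite -!vcompA //.
    rewrite whr_comp1 (whrV _ (lax_p G)) // whlr (whlV _ (lax_p F)) //.
    by rewrite -whl_comp1 (whlV _ (tp_pi A)) // whl_vcomp.
  + exact: aux.
  + exact: aux.
- rewrite lax_two_step whl_comp1 vcompA // (whlV _ (esym (lax_l F))) //.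
  rewrite whl_vcomp // -!vcompA // -whlr.
  by rewrite whr_comp1 (whrV _ (lax_l G)) // -whr_vcomp.
- rewrite vcompA // lax_two_step -vcompA // whr_comp1.
  rewrite (whrV _ (lax_c' G)) // whl_comp1 [RHS]vcompA //.
  rewrite (whlV _ (esym (lax_c' F))) //.
  by rewrite whr_vcomp // vcompA // [G ◁ (_ • (_ • _))]whl_vcomp // whlr.
Qed.

Definition lax_comp A B C (G : lax_tangent B C) (F : lax_tangent A B) :
    lax_tangent A C :=
  LaxTangent (lax_comp_subproof G F).

Lemma lax_T_subproof A : is_lax_tangent (tT A) (tc A).
Proof.
split; first by ty.
split; [exact: tpc|exact: tcz|exact: tcs| |by rewrite tYB].
have Tl : tT A ◁ tl A = (tc A ▷ tT A) • (tT A ◁ tc A) • (tl A ▷ tT A) • tc A.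
  rewrite tccl vcompA // tcc.
  by rewrite -[LHS]vcompid; congr (_ • id2 _); ty.
rewrite Tl -!vcompA // [_ • _ • (tc A ▷ tT A)]vcompA // (whrV _ (tcc A)) //.
rewrite whr_id2.
have -> : (tT A ◁ tc A) • id2 (tT A ∘ tT A ∘ tT A) = tT A ◁ tc A.
  by rewrite -[RHS]vcompid; congr (_ • id2 _); ty.
rewrite (whlV _ (tcc A)) // whl_id2 vcompA //.
by rewrite -[LHS]idvcomp; congr (id2 _ • _); ty.
Qed.

Definition lax_T A : lax_tangent A A := LaxTangent (lax_T_subproof A).

(* the category [A | B] of lax tangent morphisms and tangent 2-cells *)
Definition tng_hom A B (F G : lax_tangent A B) := {a : cell A B | is_tangent_cell F G a}.

Lemma tng_id_subproof A B (F : lax_tangent A B) : is_tangent_cell F F (id2 F).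
Proof.
split; first by ty.
rewrite whl_id2 whr_id2 -lcell_tgt idvcomp.
by rewrite -lcell_src vcompid.
Qed.

Lemma tng_comp_subproof A B (F G H : lax_tangent A B) (b : tng_hom G H)
  (a : tng_hom F G) : is_tangent_cell F H (sval b • sval a).
Proof.
case: b a => [b [[bs bt] be]] [a [[as_ at_] ae]] /=; split; first by ty.
rewrite whl_vcomp // vcompA // ae -vcompA // be vcompA //.
by rewrite -whr_vcomp.
Qed.

Definition tng_id A B (F : lax_tangent A B) : tng_hom F F := exist _ _ (tng_id_subproof F).
Definition tng_comp A B (F G H : lax_tangent A B) (b : tng_hom G H)
    (a : tng_hom F G) : tng_hom F H :=
  exist _ _ (tng_comp_subproof b a).

Lemma tng_compA A B (F G H J : lax_tangent A B) (h : tng_hom H J)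
  (g : tng_hom G H) (f : tng_hom F G) :
  tng_comp (tng_comp h g) f = tng_comp h (tng_comp g f).
Proof.
apply: sig_eq; case: h g f => [h [[? ?] _]] [g [[? ?] _]] [f [[? ?] _]] /=.
by rewrite vcompA.
Qed.
Lemma tng_comp_id A B (F G : lax_tangent A B) (f : tng_hom F G) :
  tng_comp f (tng_id F) = f.
Proof. by apply: sig_eq; case: f => [f [[fs ?] _]] /=; rewrite -{2}(vcompid f) fs. Qed.
Lemma tng_id_comp A B (F G : lax_tangent A B) (f : tng_hom F G) :
  tng_comp (tng_id G) f = f.
Proof. by apply: sig_eq; case: f => [f [[? ft] _]] /=; rewrite -{2}(idvcomp f) ft. Qed.

Definition tng_cat A B : category :=
  Category (@tng_compA A B) (@tng_comp_id A B) (@tng_id_comp A B).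

(* postcomposition with a lax tangent morphism *)
Lemma postcomp_subproof A B C (G : lax_tangent B C) (F F' : lax_tangent A B)
  (a : tng_hom F F') : is_tangent_cell (lax_comp G F) (lax_comp G F') (G ◁ sval a).
Proof.
case: a => [a [[as_ at_] ae]] /=; split; first by ty.
rewrite /= -vcompA //.
rewrite -whl_comp1 -(xchg (b := lcell G) (G := G ∘ tT B) (F' := F')) //.
rewrite vcompA // whl_comp1 (whlV _ ae) //.
by rewrite vcompA // whlr whl_vcomp.
Qed.

Definition postcomp_hom A B C (G : lax_tangent B C) (F F' : tng_cat A B)
    (a : hom F F') : @hom (tng_cat A C) (lax_comp G F) (lax_comp G F') :=
  exist _ _ (postcomp_subproof G a).

Lemma postcomp_id A B C (G : lax_tangent B C) (F : tng_cat A B) :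
  postcomp_hom G (idc F) = idc (lax_comp G F : tng_cat A C).
Proof. by apply: sig_eq; rewrite /= whl_id2. Qed.
Lemma postcomp_comp A B C (G : lax_tangent B C) (F F' F'' : tng_cat A B)
  (b : hom F' F'') (a : hom F F') :
  postcomp_hom G (compc b a) = compc (postcomp_hom G b) (postcomp_hom G a).
Proof.
apply: sig_eq; case: b a => [b [[? ?] _]] [a [[? ?] _]] /=.
by rewrite whl_vcomp.
Qed.

Definition postcomp A B C (G : lax_tangent B C) : functor (tng_cat A B) (tng_cat A C) :=
  Functor (postcomp_id G) (postcomp_comp G).

(* the tangent bundle functor of the hom-tangent category, and the components
   [p_F] of its projection *)
Definition homT A B : functor (tng_cat A B) (tng_cat A B) := postcomp A (lax_T B).

Lemma Tp_c A : (tT A ◁ tp A) • tc A = tp A ▷ tT A.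
Proof.
rewrite -tpc vcompA // tcc.
by rewrite -[RHS]vcompid; congr (_ • id2 _); ty.
Qed.

Lemma homp_subproof A B (F : tng_cat A B) :
  is_tangent_cell (homT A B F) F (tp B ▷ lmor F).
Proof.
split; first by ty.
rewrite /= -vcompA // -whlr (whrV _ (Tp_c B)) //.
rewrite -!whr_comp1 (xchg (F := F ∘ tT A) (H := id1 B)) //.
by rewrite whl_id1.
Qed.

Definition homp A B (F : tng_cat A B) : hom (homT A B F) F :=
  exist _ _ (homp_subproof F).

End Tng.
Arguments whlV {K X Y Z H b a d}.
Arguments whrV {K X Y Z H b a d}.

(** * Vector fields *)

(* The category of vector fields of a tangent category depends only on its
   tangent bundle functor [T] and on the components [p] of its projection. *)
Section VectorFields.
Variables (C : category) (T : functor C C) (p : forall M : C, hom (T M) M).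

Definition vector_field (M : C) := {v : hom M (T M) | compc (p M) v = idc M}.

Record VF_ob := VFOb { VF_base : C; VF_field : vector_field VF_base }.

Definition VF_hom (M N : VF_ob) :=
  {f : hom (VF_base M) (VF_base N) |
    compc (fhom T f) (sval (VF_field M)) = compc (sval (VF_field N)) f}.

Lemma VF_id_subproof (M : VF_ob) :
  compc (fhom T (idc (VF_base M))) (sval (VF_field M)) =
  compc (sval (VF_field M)) (idc (VF_base M)).
Proof. by rewrite fhom_id idc_comp compc_id. Qed.

Lemma VF_comp_subproof (M N P : VF_ob) (g : VF_hom N P) (f : VF_hom M N) :
  compc (fhom T (compc (sval g) (sval f))) (sval (VF_field M)) =
  compc (sval (VF_field P)) (compc (sval g) (sval f)).
Proof.
by rewrite fhom_comp compcA (svalP f) -compcA (svalP g) compcA.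
Qed.

Definition VF_id (M : VF_ob) : VF_hom M M := exist _ _ (VF_id_subproof M).
Definition VF_comp (M N P : VF_ob) (g : VF_hom N P) (f : VF_hom M N) :
  VF_hom M P := exist _ _ (VF_comp_subproof g f).

Lemma VF_compA (M N P Q : VF_ob) (h : VF_hom P Q) (g : VF_hom N P)
  (f : VF_hom M N) : VF_comp (VF_comp h g) f = VF_comp h (VF_comp g f).
Proof. by apply: sig_eq; apply: compcA. Qed.
Lemma VF_compid (M N : VF_ob) (f : VF_hom M N) : VF_comp f (VF_id M) = f.
Proof. by apply: sig_eq; apply: compc_id. Qed.
Lemma VF_idcomp (M N : VF_ob) (f : VF_hom M N) : VF_comp (VF_id N) f = f.
Proof. by apply: sig_eq; apply: idc_comp. Qed.

Definition VF_cat : category := Category VF_compA VF_compid VF_idcomp.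

End VectorFields.

(** * The construction of vector fields *)

Section Construction.
Variable K : two_category.

(* vector fields on [U] in [V | X], and VF[X' | X] *)
Definition tng_vector_field (V X : tangentad K) (U : lax_tangent V X) :=
  vector_field (@homp K V X) U.
Definition tng_VF (X' X : tangentad K) : category := VF_cat (@homp K X' X).

Variables (V X : tangentad K) (U : lax_tangent V X) (v : tng_vector_field U).
Variable X' : tangentad K.

Definition field_cell : cell V X := sval (sval v).

Lemma field_src : src field_cell = U.
Proof. by case: (svalP (sval v)) => [[]]. Qed.
Lemma field_tgt : tgt field_cell = tT X ∘ U.
Proof. by case: (svalP (sval v)) => [[]]. Qed.
Lemma field_tangent : (tT X ◁ field_cell) • lcell U =
  (tc X ▷ U) • (tT X ◁ lcell U) • (field_cell ▷ tT V).
Proof. by case: (svalP (sval v)). Qed.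
Lemma field_section : (tp X ▷ U) • field_cell = id2 U.
Proof. exact: (congr1 sval (svalP v)). Qed.

Lemma Gamma_cell_subproof (H : tng_cat X' V) :
  is_tangent_cell (postcomp X' U H) (homT X' X (postcomp X' U H))
    (field_cell ▷ lmor H).
Proof.
have fs := field_src; have ft := field_tgt.
split; first by ty.
rewrite /= -[LHS]vcompA // -whlr (whrV _ field_tangent) // !whr_vcomp //.
rewrite whl_vcomp // !vcompA // whr_comp1 whlr; congr (_ • (_ • _)).
rewrite -whl_comp1 -!whr_comp1; apply: xchg => //.
Qed.

Definition Gamma_cell (H : tng_cat X' V) :
    hom (postcomp X' U H) (homT X' X (postcomp X' U H)) :=
  exist _ _ (Gamma_cell_subproof H).

Lemma Gamma_field_subproof (H : tng_cat X' V) :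
  compc (homp (postcomp X' U H)) (Gamma_cell H) = idc _.
Proof.
have fs := field_src; have ft := field_tgt.
apply: sig_eq; rewrite /= whr_comp1.
by rewrite (whrV _ field_section) // whr_id2.
Qed.

Definition Gamma_ob (H : tng_cat X' V) : tng_VF X' X :=
  VFOb (exist _ _ (Gamma_field_subproof H) : tng_vector_field (postcomp X' U H)).

Lemma Gamma_hom_subproof (H H' : tng_cat X' V) (f : hom H H') :
  compc (fhom (homT X' X) (fhom (postcomp X' U) f)) (Gamma_cell H) =
  compc (Gamma_cell H') (fhom (postcomp X' U) f).
Proof.
apply: sig_eq => /=; case: f => [f [[fs ft] _]] /=.
rewrite -whl_comp1; symmetry; apply: xchg => //.
by split; [exact: field_src|exact: field_tgt].
Qed.

Definition Gamma_hom (H H' : tng_cat X' V) (f : hom H H') :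
    hom (Gamma_ob H) (Gamma_ob H') :=
  exist _ _ (Gamma_hom_subproof f).

Lemma Gamma_id (H : tng_cat X' V) : Gamma_hom (idc H) = idc (Gamma_ob H).
Proof. by apply: sig_eq; apply: fhom_id. Qed.
Lemma Gamma_comp (H H' H'' : tng_cat X' V) (g : hom H' H'') (f : hom H H') :
  Gamma_hom (compc g f) = compc (Gamma_hom g) (Gamma_hom f).
Proof. by apply: sig_eq; apply: fhom_comp. Qed.

(* (H, gamma) |-> (U ∘ (H, gamma), v_H),  phi |-> U phi *)
Definition Gamma : functor (tng_cat X' V) (tng_VF X' X) :=
  Functor Gamma_id Gamma_comp.

End Construction.

(* A strict tangent morphism is invertible exactly when its underlying functor
   is: the inverse of the functor is then again strict. *)
Definition is_universal_vector_field (K : two_category) (V X : tangentad K)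
    (U : lax_tangent V X) (v : tng_vector_field U) : Prop :=
  is_strict U /\ forall X' : tangentad K, is_cat_iso (Gamma v X').

Definition admits_vector_fields (K : two_category) (X : tangentad K) : Prop :=
  exists (V : tangentad K) (U : lax_tangent V X) (v : tng_vector_field U),
    is_universal_vector_field v.

(** * Inserters and equifiers *)

Section HomCat.
Variable K : two_category.

Definition cell_hom (Y X : K) (H H' : mor Y X) := {a : cell Y X | from_to H H' a}.

Lemma cell_id_subproof (Y X : K) (H : mor Y X) : from_to H H (id2 H).
Proof. by []. Qed.
Lemma cell_comp_subproof (Y X : K) (H H' H'' : mor Y X) (b : cell_hom H' H'')
  (a : cell_hom H H') : from_to H H'' (sval b • sval a).
Proof. by case: b a => [b [? ?]] [a [? ?]] /=. Qed.

Definition cell_id (Y X : K) (H : mor Y X) : cell_hom H H :=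
  exist _ _ (cell_id_subproof H).
Definition cell_comp (Y X : K) (H H' H'' : mor Y X) (b : cell_hom H' H'')
    (a : cell_hom H H') : cell_hom H H'' :=
  exist _ _ (cell_comp_subproof b a).

Lemma cell_compA (Y X : K) (F G H J : mor Y X) (h : cell_hom H J)
  (g : cell_hom G H) (f : cell_hom F G) :
  cell_comp (cell_comp h g) f = cell_comp h (cell_comp g f).
Proof.
apply: sig_eq; case: h g f => [h [? ?]] [g [? ?]] [f [? ?]] /=.
by rewrite vcompA.
Qed.
Lemma cell_comp_id (Y X : K) (F G : mor Y X) (f : cell_hom F G) :
  cell_comp f (cell_id F) = f.
Proof. by apply: sig_eq; case: f => [f [fs ft]] /=; rewrite -{2}(vcompid f) fs. Qed.
Lemma cell_id_comp (Y X : K) (F G : mor Y X) (f : cell_hom F G) :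
  cell_comp (cell_id G) f = f.
Proof. by apply: sig_eq; case: f => [f [fs ft]] /=; rewrite -{2}(idvcomp f) ft. Qed.

Definition hom_cat (Y X : K) : category :=
  Category (@cell_compA Y X) (@cell_comp_id Y X) (@cell_id_comp Y X).

Section Insert.
Variables (X X' : K) (F G : mor X X') (Y : K).

Record insert_ob := InsertOb {
  ins_mor : mor Y X;
  ins_cell : cell Y X';
  ins_ft : from_to (F ∘ ins_mor) (G ∘ ins_mor) ins_cell
}.

Definition insert_hom (H H' : insert_ob) :=
  {a : hom (ins_mor H : hom_cat Y X) (ins_mor H') |
    ins_cell H' • (F ◁ sval a) = (G ◁ sval a) • ins_cell H}.

Lemma insert_id_subproof (H : insert_ob) :
  ins_cell H • (F ◁ id2 (ins_mor H)) = (G ◁ id2 (ins_mor H)) • ins_cell H.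
Proof.
by case: H => [H t [ts_ tt]] /=; rewrite !whl_id2 -ts_ -tt vcompid idvcomp.
Qed.
Lemma insert_comp_subproof (H H' H'' : insert_ob) (b : insert_hom H' H'')
  (a : insert_hom H H') :
  ins_cell H'' • (F ◁ (sval (sval b) • sval (sval a))) =
  (G ◁ (sval (sval b) • sval (sval a))) • ins_cell H.
Proof.
have [? ?] := ins_ft H; have [? ?] := ins_ft H'; have [? ?] := ins_ft H''.
case: b a => [[b [? ?]] /= be] [[a [? ?]] /= ae].
rewrite !whl_vcomp // -vcompA // be vcompA // ae.
by rewrite -vcompA.
Qed.

Definition insert_id (H : insert_ob) : insert_hom H H :=
  exist _ (idc _) (insert_id_subproof H).
Definition insert_comp (H H' H'' : insert_ob) (b : insert_hom H' H'')
    (a : insert_hom H H') : insert_hom H H'' :=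
  exist _ (compc (sval b) (sval a)) (insert_comp_subproof b a).

Lemma insert_compA (H0 H1 H2 H3 : insert_ob) (h : insert_hom H2 H3)
  (g : insert_hom H1 H2) (f : insert_hom H0 H1) :
  insert_comp (insert_comp h g) f = insert_comp h (insert_comp g f).
Proof. by apply: sig_eq; apply: compcA. Qed.
Lemma insert_comp_id (H H' : insert_ob) (f : insert_hom H H') :
  insert_comp f (insert_id H) = f.
Proof. by apply: sig_eq; apply: compc_id. Qed.
Lemma insert_id_comp (H H' : insert_ob) (f : insert_hom H H') :
  insert_comp (insert_id H') f = f.
Proof. by apply: sig_eq; apply: idc_comp. Qed.

Definition insert_cat : category :=
  Category insert_compA insert_comp_id insert_id_comp.

Variables (I : K) (V : mor I X) (th : cell I X') (th_ft : from_to (F ∘ V) (G ∘ V) th).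

Lemma insert_cmp_ob_subproof (H : mor Y I) :
  from_to (F ∘ (V ∘ H)) (G ∘ (V ∘ H)) (th ▷ H).
Proof. by case: th_ft. Qed.

Definition insert_cmp_ob (H : hom_cat Y I) : insert_cat :=
  InsertOb (insert_cmp_ob_subproof H).

Lemma insert_cmp_whl_subproof (H H' : hom_cat Y I) (a : hom H H') :
  from_to (V ∘ H) (V ∘ H') (V ◁ sval a).
Proof. by case: a => [a [/= ? ?]]; ty. Qed.

Lemma insert_cmp_hom_subproof (H H' : hom_cat Y I) (a : hom H H') :
  (th ▷ H') • (F ◁ (V ◁ sval a)) = (G ◁ (V ◁ sval a)) • (th ▷ H).
Proof.
case: a => [a [/= ? ?]]; rewrite -!whl_comp1; exact: xchg.
Qed.

Definition insert_cmp_hom (H H' : hom_cat Y I) (a : hom H H') :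
    hom (insert_cmp_ob H) (insert_cmp_ob H') :=
  exist _ (exist _ _ (insert_cmp_whl_subproof a)) (insert_cmp_hom_subproof a).

Lemma insert_cmp_id (H : hom_cat Y I) :
  insert_cmp_hom (idc H) = idc (insert_cmp_ob H).
Proof. by apply: sig_eq; apply: sig_eq; apply: whl_id2. Qed.
Lemma insert_cmp_comp (H H' H'' : hom_cat Y I) (b : hom H' H'') (a : hom H H') :
  insert_cmp_hom (compc b a) = compc (insert_cmp_hom b) (insert_cmp_hom a).
Proof.
apply: sig_eq; apply: sig_eq; case: b a => [b [? ?]] [a [? ?]] /=.
by apply: whl_vcomp.
Qed.

(* H |-> (V ∘ H, th_H),  psi |-> V psi *)
Definition insert_cmp : functor (hom_cat Y I) insert_cat :=
  Functor insert_cmp_id insert_cmp_comp.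

End Insert.

Definition is_inserter (X X' : K) (F G : mor X X') (I : K) (V : mor I X)
    (th : cell I X') : Prop :=
  exists th_ft : from_to (F ∘ V) (G ∘ V) th,
    forall Y : K, is_cat_iso (insert_cmp Y th_ft).

Section Equif.
Variables (X X' : K) (phi psi : cell X X') (Y : K).

Definition equif_ob := {H : mor Y X | phi ▷ H = psi ▷ H}.

Definition equif_cat : category :=
  @Category equif_ob (fun H H' => @hom (hom_cat Y X) (sval H) (sval H'))
    (fun H => @idc (hom_cat Y X) (sval H))
    (fun H H' H'' => @compc (hom_cat Y X) (sval H) (sval H') (sval H''))
    (fun _ _ _ _ => @compcA (hom_cat Y X) _ _ _ _)
    (fun _ _ => @compc_id (hom_cat Y X) _ _)
    (fun _ _ => @idc_comp (hom_cat Y X) _ _).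

Variables (E : K) (W : mor E X) (eW : phi ▷ W = psi ▷ W).

Lemma equif_cmp_ob_subproof (H : mor Y E) : phi ▷ (W ∘ H) = psi ▷ (W ∘ H).
Proof. by rewrite !whr_comp1 eW. Qed.

Definition equif_cmp_ob (H : hom_cat Y E) : equif_cat :=
  exist _ _ (equif_cmp_ob_subproof H).

Lemma equif_cmp_subproof (H H' : hom_cat Y E) (a : hom H H') :
  from_to (W ∘ H) (W ∘ H') (W ◁ sval a).
Proof. by case: a => [a [/= ? ?]]; ty. Qed.

Definition equif_cmp_hom (H H' : hom_cat Y E) (a : hom H H') :
    hom (equif_cmp_ob H) (equif_cmp_ob H') :=
  exist _ _ (equif_cmp_subproof a).

Lemma equif_cmp_id (H : hom_cat Y E) :
  equif_cmp_hom (idc H) = idc (equif_cmp_ob H).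
Proof. by apply: sig_eq; apply: whl_id2. Qed.
Lemma equif_cmp_comp (H H' H'' : hom_cat Y E) (b : hom H' H'') (a : hom H H') :
  equif_cmp_hom (compc b a) = compc (equif_cmp_hom b) (equif_cmp_hom a).
Proof.
apply: sig_eq; case: b a => [b [? ?]] [a [? ?]] /=.
by apply: whl_vcomp.
Qed.

Definition equif_cmp : functor (hom_cat Y E) equif_cat :=
  Functor equif_cmp_id equif_cmp_comp.

End Equif.

Definition is_equifier (X X' : K) (phi psi : cell X X') (E : K) (W : mor E X) :
    Prop :=
  exists eW : phi ▷ W = psi ▷ W, forall Y : K, is_cat_iso (equif_cmp Y eW).

(** * Induced tangent structures *)

(* Postcomposition with [J] carries the tangent structure [H |-> T' ∘ H] on
   [K(Y, I)] to [H |-> T ∘ H] on [K(Y, X)], with the same structural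
   transformations.  The chosen pullbacks of [t'] need not be carried to those
   of [t]; the pairing in the clause for [ts] is the comparison. *)
Definition lifts_along (I X : K) (J : mor I X) (t' : tangent_structure I)
    (t : tangent_structure X) : Prop :=
  forall Y : K,
    (forall a : cell Y I, J ◁ (tT t' ◁ a) = tT t ◁ (J ◁ a)) /\
    forall H : mor Y I,
      J ∘ (tT t' ∘ H) = tT t ∘ (J ∘ H) /\
      [/\ J ◁ (tp t' ▷ H) = tp t ▷ (J ∘ H),
          J ◁ (tz t' ▷ H) = tz t ▷ (J ∘ H),
          J ◁ (ts t' ▷ H) = (ts t ▷ (J ∘ H)) •
            pairing (tpi t 2 0 ▷ (J ∘ H)) (tpi t 2 1 ▷ (J ∘ H))
              (J ◁ (tpi t' 2 0 ▷ H)) (J ◁ (tpi t' 2 1 ▷ H)),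
          J ◁ (tl t' ▷ H) = tl t ▷ (J ∘ H)
        & J ◁ (tc t' ▷ H) = tc t ▷ (J ∘ H)].

(* [tI] corresponds, under K(-, I) = Insert[-; id, T], to
   (H, tau) |-> (T ∘ H, c_H • T tau). *)
Definition inserter_induced (I X : K) (V : mor I X) (th : cell I X)
    (tI : tangent_structure I) (t : tangent_structure X) : Prop :=
  lifts_along V tI t /\
  forall (Y : K) (H : mor Y I),
    th ▷ (tT tI ∘ H) = (tc t ▷ (V ∘ H)) • (tT t ◁ (th ▷ H)).

(* [tE] corresponds, under K(-, E) = Equif, to H |-> T^I ∘ H. *)
Definition equifier_induced (E I : K) (W : mor E I)
    (tE : tangent_structure E) (tI : tangent_structure I) : Prop :=
  lifts_along W tE tI.

End HomCat.

(* Main.v *)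
From mathcomp Require Import ssreflect ssrfun ssrbool eqtype ssrnat.
From Stdlib Require Import ClassicalEpsilon ProofIrrelevance.
Require Import Defs.

Set Implicit Arguments.
Unset Strict Implicit.
Unset Printing Implicit Defensive.

Local Open Scope cell_scope.

(** A vector field on a 1-morphism [H] is a 2-cell [tau : H => T ∘ H] with
    [p_H • tau = id].  The inserter [I] of [id] and [T] classifies the pairs
    [(H, tau)], and the equifier [E] imposes the section equation, so [E]
    already represents vector fields on 1-morphisms into [X], with universal
    one [theta_W] on [V ∘ W].  It remains to see that the tangent structures
    match: that [I] and [E] inherit one from [X], and that a lax tangent
    morphism into [E] is the same thing as a lax tangent morphism into [X]
    with a vector field that is moreover a tangent 2-morphism.

    Both [I] and [E] are treated at once as a field object: an object [O] with
    [J : O -> X] and [th : J => T ∘ J], universal among pairs [(H, tau)] which,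
    if the flag [S] holds, satisfy the section equation ([S] is [False] for
    [I] and [True] for [E]).  A 2-cell [phi : J ∘ G => J ∘ G'] lifts along
    [J], in a unique way, exactly when it commutes with [th].

    The tangent structure of a field object is obtained by lifting.  Its
    1-morphism is the lift of [(T ∘ J, c_J • T th)], and each of [p, z, s, l, c]
    whiskered by [J] commutes with the fields involved, by naturality and the
    axioms relating it to [c].  The equations lift because [J] is faithful on
    2-cells.  The pullbacks lift because a mediating 2-cell of [X] commutes
    with the fields as soon as the [T]-image of the limit cone is jointly
    monic ([creates_fibre_power], [creates_pullback]).  For the fibre powers of
    [p] this is an axiom, since [T] preserves them.  For the universality of
    the vertical lift it has to be proved ([T_lift_cell_mono]): as [(T, c)] is
    a lax tangent endomorphism with [c] invertible, the [T]-image of that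
    square is compared with the same square precomposed with [T], which is a
    pullback by pointwiseness.

    For the universal property ([field_object_universal]), let [(H, gamma)] be
    a lax tangent morphism with a vector field [tau].  The pair [(H, tau)]
    lifts to [G].  That [tau] is a tangent 2-morphism says, as [c • c = id],
    precisely that [gamma] commutes with the fields induced on its source and
    target, hence lifts to some [d]; the lax tangent axioms for [(G, d)] follow
    by faithfulness ([lax_reflect]).  That argument uses only that [J] is
    strict and that [th_T' = c_J • T th], so it applies to every choice of
    induced structures. *)

(** * Boundaries, pullbacks and pairings *)

(** Computes boundaries of pasted 2-cells modulo the equations between composite
    1-morphisms found in the context; those of the form [J ∘ T' = T ∘ J] must
    also be applied inside right-nested composites. *)
Ltac typed :=
  try (split; typed);
  repeat first
    [ progress rewrite ?stE
    | rewrite src_vcomp; [|solve [typed]]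
    | rewrite tgt_vcomp; [|solve [typed]]
    | rewrite tpi_src; [|by []]
    | rewrite tpi_tgt; [|by []]
    | match goal with
      | H : src ?a = _ |- context [src ?a] => rewrite H
      | H : tgt ?a = _ |- context [tgt ?a] => rewrite H
      | H : ?a ∘ ?b = _ |- context [?a ∘ ?b] => rewrite H
      | H : ?a ∘ ?b = _ |- context [?a ∘ (?b ∘ ?c)] => rewrite -(comp1A a b c) H
      end ];
  reflexivity.
#[local] Hint Extern 0 (tgt _ = src _) => typed : core.
#[local] Hint Extern 0 (src _ = _) => typed : core.
#[local] Hint Extern 0 (tgt _ = _) => typed : core.
#[local] Hint Extern 0 (from_to _ _ _) => typed : core.

Section Pullbacks.
Variable K : two_category.
Implicit Types X Y Z : K.

Lemma vcomp_idl X Y (a : cell X Y) F : tgt a = F -> id2 F • a = a.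
Proof. by move=> <-; apply: idvcomp. Qed.
Lemma vcomp_idr X Y (a : cell X Y) F : src a = F -> a • id2 F = a.
Proof. by move=> <-; apply: vcompid. Qed.

Lemma fibre_power_mono X Y n (p : cell X Y) P pi A u w :
  is_fibre_power n p P pi -> from_to A P u -> from_to A P w ->
  (forall k, k < n -> pi k • u = pi k • w) -> u = w.
Proof.
case=> piP pe univ [us ut] [ws wt] uw.
have [||v [_ vU]] := univ A (fun k => pi k • u).
- by move=> k kn; have [? ?] := piP k kn.
- move=> j k jn kn; have [? ?] := piP j jn; have [? ?] := piP k kn.
  by rewrite -!vcompA // (pe j k).
rewrite -(vU u) ?(vU w) //; split=> // k kn.
by rewrite uw.
Qed.

Lemma fibre_power_ft X Y n (p : cell X Y) P pi k : is_fibre_power n p P pi ->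
  k < n -> from_to P (src p) (pi k).
Proof. by case=> piP _ _ /piP. Qed.

Lemma eq_fibre_power X Y n (p p' : cell X Y) P P' pi pi' :
  p = p' -> P = P' -> (forall k, k < n -> pi k = pi' k) ->
  is_fibre_power n p P pi -> is_fibre_power n p' P' pi'.
Proof.
move=> <- <- e [piP pe univ]; split=> [k kn|j k jn kn|A f fA fe].
- by rewrite -e //; apply: piP.
- by rewrite -!e //; apply: pe.
have [u [[uP ue] uU]] := univ A f fA fe.
exists u; split=> [|w [wP we]]; first by split=> // k kn; rewrite -e ?ue.
by apply: uU; split=> // k kn; rewrite e ?we.
Qed.

(** [pairing_spec] with the source of the cone as a free variable, which spares
    the computation of [src a]. *)
Lemma fibre_power_pair X Y (p : cell X Y) P pi a b A :
  is_fibre_power 2 p P pi -> from_to A (src p) a -> from_to A (src p) b ->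
  p • a = p • b ->
  [/\ from_to A P (pairing (pi 0) (pi 1) a b),
    pi 0 • pairing (pi 0) (pi 1) a b = a & pi 1 • pairing (pi 0) (pi 1) a b = b].
Proof.
move=> pb [as_ at_] [bs bt] e.
by have := pairing_spec pb erefl erefl _ _ e; rewrite as_; apply.
Qed.

Lemma pullback_mono X Y (P A B C : mor X Y) top left right bot D u w :
  is_pullback P A B C top left right bot -> from_to D P u -> from_to D P w ->
  top • u = top • w -> left • u = left • w -> u = w.
Proof.
case=> [[[ts tt] [ls lt] [rs rt] [bs bt]] [e univ]] [us ut] [ws wt] e1 e2.
have [|||v [_ vU]] := univ D (top • u) (left • u); try by typed.
  by rewrite -!vcompA // e.
by rewrite -(vU u) ?(vU w).
Qed.

End Pullbacks.

(** * The universal lift is kept jointly monic by T *)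

Section Lift.
Variables (K : two_category).

Definition lift_cell (X : K) (t : tangent_structure X) : cell X X :=
  (tT t ◁ ts t) • pairing (tT t ◁ tpi t 2 0) (tT t ◁ tpi t 2 1)
                   (tl t • tpi t 2 0) ((tz t ▷ tT t) • tpi t 2 1).

Lemma whl_fibre_power (X Y : K) (t : tangent_structure X) n m (F : mor Y X) :
  0 < n -> is_fibre_power n (iter1 (tT t) m ◁ (tp t ▷ F))
    (iter1 (tT t) m ∘ (tTn t n ∘ F)) (fun k => iter1 (tT t) m ◁ (tpi t n k ▷ F)).
Proof.
move=> n0; case: (tTn_preserved t m n0) => _ /(_ Y F).
by apply: eq_fibre_power => [||k _]; rewrite ?whlr ?comp1A.
Qed.

Lemma T_fibre_power (X Y : K) (t : tangent_structure X) n (F : mor Y X) :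
  0 < n -> is_fibre_power n (tT t ◁ (tp t ▷ F))
    (tT t ∘ (tTn t n ∘ F)) (fun k => tT t ◁ (tpi t n k ▷ F)).
Proof. by move/(whl_fibre_power t 1 F); rewrite /= comp1id. Qed.

Lemma T_fibre_power_id (X : K) (t : tangent_structure X) n :
  0 < n -> is_fibre_power n (tT t ◁ tp t)
    (tT t ∘ tTn t n) (fun k => tT t ◁ tpi t n k).
Proof.
move/(T_fibre_power t (id1 X)).
by apply: eq_fibre_power => [||k _]; rewrite ?whr_id1 ?comp1id.
Qed.

Lemma whr_fibre_power (X Y : K) (t : tangent_structure X) n (F : mor Y X) :
  0 < n -> is_fibre_power n (tp t ▷ F) (tTn t n ∘ F) (fun k => tpi t n k ▷ F).
Proof. by case/(tTn_pointwise t) => _; apply. Qed.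

Lemma tp_tpi (X : K) (t : tangent_structure X) n j k : j < n -> k < n ->
  tp t • tpi t n j = tp t • tpi t n k.
Proof.
move=> jn kn; have n0 : 0 < n by apply: leq_ltn_trans jn.
by case: (tTn_pointwise t n0) => [[_ e _] _]; apply: e.
Qed.

Lemma lift_cell_cone (X : K) (t : tangent_structure X) :
  (tT t ◁ tp t) • (tl t • tpi t 2 0) =
  (tT t ◁ tp t) • ((tz t ▷ tT t) • tpi t 2 1).
Proof.
rewrite -!vcompA // tpl vcompA // (tp_tpi t (isT : 0 < 2) (isT : 1 < 2)).
rewrite -[LHS]vcompA //; congr (_ • _).
by rewrite -(xchg (tz_ft t) (tp_ft t)) whr_id1 whl_id1.
Qed.

Lemma lift_cell_pairing (X : K) (t : tangent_structure X) :
  let u := pairing (tT t ◁ tpi t 2 0) (tT t ◁ tpi t 2 1)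
                   (tl t • tpi t 2 0) ((tz t ▷ tT t) • tpi t 2 1) in
  [/\ from_to (tTn t 2) (tT t ∘ tTn t 2) u,
     (tT t ◁ tpi t 2 0) • u = tl t • tpi t 2 0 &
     (tT t ◁ tpi t 2 1) • u = (tz t ▷ tT t) • tpi t 2 1].
Proof.
have sE : src (tl t • tpi t 2 0) = tTn t 2 by typed.
have := pairing_spec (T_fibre_power_id t (isT : 0 < 2)) erefl erefl
  (a := tl t • tpi t 2 0) (b := (tz t ▷ tT t) • tpi t 2 1).
by rewrite sE; apply=> //; apply: lift_cell_cone.
Qed.

Lemma lift_cell_ft (X : K) (t : tangent_structure X) :
  from_to (tTn t 2) (tT t ∘ tT t) (lift_cell t).
Proof. by have [[us ut] _ _] := lift_cell_pairing t; rewrite /lift_cell; typed. Qed.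

(** A lax tangent morphism is compatible with [s], [l] and [z], and
    [lift_cell = T s • <l pi0, z_T pi1>] is built from these; so it commutes with
    [lift_cell] up to the 2-cell [u] which it induces on [T_2]. *)
Lemma lax_lift_cell (A B : tangentad K) (F : lax_tangent A B) :
  let u := pairing (tpi B 2 0 ▷ F) (tpi B 2 1 ▷ F)
    (lcell F • (F ◁ tpi A 2 0)) (lcell F • (F ◁ tpi A 2 1)) in
  (lift_cell B ▷ F) • u = (tT B ◁ lcell F) • (lcell F ▷ tT A) • (F ◁ lift_cell A).
Proof.
have [] := lax_pair_spec F; have := lax_s F; rewrite /=.
set al2 := pairing _ _ _ _ => sF [us ut] u0 u1.
rewrite /lift_cell; have [] := lift_cell_pairing A; set uA := pairing _ _ _ _.
move=> [uAs uAt] uA0 uA1.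
have [] := lift_cell_pairing B; set uB := pairing _ _ _ _.
move=> [uBs uBt] uB0 uB1.
have -> : (tT B ◁ lcell F) • (lcell F ▷ tT A) • (F ◁ ((tT A ◁ ts A) • uA)) =
  (tT B ◁ (ts B ▷ F)) • ((tT B ◁ al2) • (lcell F ▷ tTn A 2) • (F ◁ uA)).
  rewrite whl_vcomp // -vcompA // -whl_comp1.
  rewrite [_ • _ • (_ ◁ ts A)]vcompA //.
  rewrite (xchg (G := F ∘ tT A) (H := tT B ∘ F) (F := tTn A 2)) //.
  rewrite whl_comp1 -[_ • ((_ ◁ _) • _)]vcompA // -whl_vcomp // sF whl_vcomp //.
  by rewrite !vcompA.
rewrite whr_vcomp // whlr vcompA //; congr (_ • _).
apply: (fibre_power_mono (T_fibre_power B F (isT : 0 < 2))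
          (A := F ∘ tTn A 2)) => //.
have aux k : k < 2 -> (tpi B 2 k ▷ F) • al2 = lcell F • (F ◁ tpi A 2 k) ->
  (tT B ◁ (tpi B 2 k ▷ F)) • ((tT B ◁ al2) • (lcell F ▷ tTn A 2) • (F ◁ uA)) =
  (tT B ◁ lcell F) • (lcell F ▷ tT A) • (F ◁ ((tT A ◁ tpi A 2 k) • uA)).
  move=> k2 e; have ? := tpi_src A k2; have ? := tpi_tgt A k2.
  have ? := tpi_src B k2; have ? := tpi_tgt B k2.
  rewrite -!vcompA // -whl_vcomp // e whl_vcomp // whl_vcomp // !vcompA //.
  congr (_ • _); rewrite -[LHS]vcompA // -[RHS]vcompA //; congr (_ • _).
  by rewrite -!whl_comp1; symmetry; apply: xchg.
case=> [|[|//]] _.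
- rewrite aux // uA0 -vcompA // -whlr -whr_vcomp // uB0 whr_vcomp // vcompA // u0.
  by rewrite -vcompA // lax_l whl_vcomp // !vcompA.
- rewrite aux // uA1 -vcompA // -whlr -whr_vcomp // uB1 whr_vcomp // vcompA // u1.
  rewrite whl_vcomp // -whlr -!vcompA //; congr (_ • _).
  rewrite [RHS]vcompA // -whr_vcomp // lax_z.
  by rewrite -!whr_comp1 -{1}(whl_id1 (lcell F)); apply: xchg.
Qed.

(** The universality of the vertical lift makes [lift_cell] and [p pi0] jointly
    monic after precomposition with any 1-morphism, but says nothing of their
    [T]-images.  Let [al : T ∘ T_2 => T_2 ∘ T] be the 2-cell induced by [c].  By
    [lax_lift_cell] for [(T, c)], 2-cells that agree after the [T]-images of
    [lift_cell] and [p pi0] agree, once composed with [al], after these two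
    precomposed with [T]; so they agree after [al].  And [al] is monic
    because [c] is invertible and the [T pi_k] are jointly monic. *)
Lemma T_lift_cell_mono (X : tangentad K) (Y : K) (F : mor Y X) D u w :
  from_to D (tT X ∘ (tTn X 2 ∘ F)) u -> from_to D (tT X ∘ (tTn X 2 ∘ F)) w ->
  (tT X ◁ (lift_cell X ▷ F)) • u = (tT X ◁ (lift_cell X ▷ F)) • w ->
  (tT X ◁ ((tp X • tpi X 2 0) ▷ F)) • u =
  (tT X ◁ ((tp X • tpi X 2 0) ▷ F)) • w -> u = w.
Proof.
move=> [us ut] [ws wt] e1 e2.
have [vs vt] := lift_cell_ft X.
have := lax_pair_spec (lax_T X); have := lax_lift_cell (lax_T X); rewrite /=.
set al := pairing _ _ _ _ => ev [[als alt] al0 al1].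
have alE : (al ▷ F) • u = (al ▷ F) • w.
  have [_ /(_ Y (tT X ∘ F)) pb] := tlift X.
  apply: (pullback_mono pb) => //; rewrite -/(lift_cell X).
  - by rewrite -!vcompA // !whr_comp1 -!whr_vcomp // ev whr_vcomp //
      whlr !vcompA // e1.
  (* p_T pi0_T al = p_T c (T pi0) = T (p pi0) *)
  - have E : ((tp X • tpi X 2 0) ▷ (tT X ∘ F)) • (al ▷ F) =
             tT X ◁ ((tp X • tpi X 2 0) ▷ F).
      rewrite whr_comp1 -whr_vcomp // [(_ • _) ▷ tT X]whr_vcomp //.
      rewrite vcompA // al0 -vcompA //.
      by rewrite tpc -whl_vcomp // whlr.
    by rewrite -!vcompA // E.
apply: (fibre_power_mono (T_fibre_power X F (isT : 0 < 2)) (A := D)) => //.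
have aux k : k < 2 -> (tpi X 2 k ▷ tT X) • al = tc X • (tT X ◁ tpi X 2 k) ->
  tT X ◁ (tpi X 2 k ▷ F) = (tc X ▷ F) • (((tpi X 2 k ▷ tT X) ▷ F) • (al ▷ F)).
  move=> k2 e; have ? := tpi_src X k2; have ? := tpi_tgt X k2.
  rewrite -whr_vcomp // e -whr_vcomp // -vcompA // tcc vcomp_idl // whlr //.
by case=> [|[|//]] _; rewrite aux // !vcompA // alE.
Qed.

End Lift.

(** * Field objects *)

(** The common generalisation of the inserter ([S := False]) and of the
    equifier in that inserter ([S := True]).  Its tangent structure and that of
    the equifier are then instances of a single construction. *)
Definition is_field_object (K : two_category) (X : tangentad K) (S : Prop)
    (O : K) (J : mor O X) (th : cell O X) : Prop :=
  [/\ from_to J (tT X ∘ J) th,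
      S -> (tp X ▷ J) • th = id2 J,
      forall (Y : K) (H : mor Y X) tau, from_to H (tT X ∘ H) tau ->
        (S -> (tp X ▷ H) • tau = id2 H) ->
        exists! G : mor Y O, J ∘ G = H /\ th ▷ G = tau
    & forall (Y : K) (G G' : mor Y O) phi, from_to (J ∘ G) (J ∘ G') phi ->
        (th ▷ G') • phi = (tT X ◁ phi) • (th ▷ G) ->
        exists! a, from_to G G' a /\ J ◁ a = phi].

Section FieldObject.
Variables (K : two_category) (X : tangentad K) (S : Prop) (O : K).
Variables (J : mor O X) (th : cell O X).
Variable fo : is_field_object S J th.

Local Notation T := (tT X).
Local Notation p := (tp X).
Local Notation z := (tz X).
Local Notation s := (ts X).
Local Notation l := (tl X).
Local Notation c := (tc X).
Local Notation Tn := (tTn X).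
Local Notation pi := (tpi X).

Lemma field_object_src : src th = J. Proof. by case: fo => [[]]. Qed.
Lemma field_object_tgt : tgt th = T ∘ J. Proof. by case: fo => [[]]. Qed.

Lemma field_nat (Y : K) (a : cell Y O) G G' : from_to G G' a ->
  (th ▷ G') • (J ◁ a) = (T ◁ (J ◁ a)) • (th ▷ G).
Proof.
by case: fo => theta_ft _ _ _ aft; rewrite -whl_comp1; apply: xchg.
Qed.

Lemma field_faithful (Y : K) (a b : cell Y O) :
  src a = src b -> tgt a = tgt b -> J ◁ a = J ◁ b -> a = b.
Proof.
move=> es et e; have ths := field_object_src; have tht := field_object_tgt.
case: fo => _ _ _ full.
have [|d [_ dU]] := full Y (src a) (tgt a) (J ◁ a) _ (field_nat (conj erefl erefl)).
  by [].
by rewrite -(dU a) // (dU b).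
Qed.

Lemma field_full (Y : K) (G G' : mor Y O) phi :
  from_to (J ∘ G) (J ∘ G') phi -> (th ▷ G') • phi = (T ◁ phi) • (th ▷ G) ->
  exists a, from_to G G' a /\ J ◁ a = phi.
Proof.
by case: fo => _ _ _ full ft e; have [a [? _]] := full Y G G' phi ft e; exists a.
Qed.

Lemma field_mor_inj (Y : K) (G G' : mor Y O) :
  J ∘ G = J ∘ G' -> th ▷ G = th ▷ G' -> G = G'.
Proof.
have ths := field_object_src; have tht := field_object_tgt.
case: fo => _ sec lift _ e1 e2.
have [||G0 [_ G0U]] := lift Y (J ∘ G) (th ▷ G); first by [].
  by move=> hS; rewrite whr_comp1 -whr_vcomp // sec // whr_id2.
by rewrite -(G0U G) // (G0U G').
Qed.

(** The mediating 2-cell [u] exists in [X]; to lift it, [th • u = T u • th] is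
    tested against the [T]-images of the projections, where it holds since the
    projections and the cone [f] are themselves 2-cells of [O]. *)
Lemma creates_fibre_power (Y : K) n (q : cell Y O) P pr :
  is_fibre_power n (J ◁ q) (J ∘ P) (fun k => J ◁ pr k) ->
  is_fibre_power n (T ◁ (J ◁ q)) (T ∘ (J ∘ P)) (fun k => T ◁ (J ◁ pr k)) ->
  (forall k, k < n -> from_to P (src q) (pr k)) ->
  is_fibre_power n q P pr.
Proof.
have ths := field_object_src; have tht := field_object_tgt.
move=> pb Tpb prP; have [_ Je Juniv] := pb.
split=> // [j k jn kn|A f fA fe].
  have [? ?] := prP j jn; have [? ?] := prP k kn.
  by apply: field_faithful => //; rewrite !whl_vcomp // (Je j k).
have [||u [[uP ue] uU]] := Juniv (J ∘ A) (fun k => J ◁ f k).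
- by move=> k kn; have [? ?] := fA k kn.
- move=> j k jn kn; have [? ?] := fA j jn; have [? ?] := fA k kn.
  by rewrite -!whl_vcomp // (fe j k).
have [us ut] := uP.
have [|v [[vs vt] vu]] := field_full uP.
  apply: (fibre_power_mono Tpb (A := J ∘ A)) => // k kn.
  have [? ?] := prP k kn; have [? ?] := fA k kn.
  rewrite -!vcompA // -(field_nat (prP k kn)) vcompA // -whl_vcomp // ue //.
  exact: field_nat.
exists v; split=> [|w [[ws wt] we]].
  split=> // k kn; have [? ?] := prP k kn; have [? ?] := fA k kn.
  by apply: field_faithful => //; rewrite whl_vcomp // vu ue.
apply: field_faithful => //; rewrite vu; apply: uU; split=> // k kn.
by have [? ?] := prP k kn; rewrite -whl_vcomp // we.
Qed.

(** As for fibre powers; the [T]-image of the square need not be a pullback,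
    only its projections have to be jointly monic. *)
Lemma creates_pullback (Y : K) (P A B C : mor Y O) top left right bot :
  from_to P A top -> from_to P B left -> from_to A C right -> from_to B C bot ->
  is_pullback (J ∘ P) (J ∘ A) (J ∘ B) (J ∘ C)
    (J ◁ top) (J ◁ left) (J ◁ right) (J ◁ bot) ->
  (forall D u w, from_to D (T ∘ (J ∘ P)) u -> from_to D (T ∘ (J ∘ P)) w ->
    (T ◁ (J ◁ top)) • u = (T ◁ (J ◁ top)) • w ->
    (T ◁ (J ◁ left)) • u = (T ◁ (J ◁ left)) • w -> u = w) ->
  is_pullback P A B C top left right bot.
Proof.
have ths := field_object_src; have tht := field_object_tgt.
move=> tP lP rP bP [_ [Je Juniv]] mono.
have [? ?] := tP; have [? ?] := lP; have [? ?] := rP; have [? ?] := bP.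
split=> //; split=> [|D a b aD bD ab].
  by apply: field_faithful => //; rewrite !whl_vcomp.
have [? ?] := aD; have [? ?] := bD.
have [|||u [[uP [u1 u2]] uU]] := Juniv (J ∘ D) (J ◁ a) (J ◁ b); try by typed.
  by rewrite -!whl_vcomp // ab.
have [us ut] := uP.
have [|v [[vs vt] vu]] := field_full uP.
  apply: (mono (J ∘ D)) => //.
  - rewrite -!vcompA // -(field_nat tP) vcompA // -whl_vcomp // u1.
    exact: field_nat.
  - rewrite -!vcompA // -(field_nat lP) vcompA // -whl_vcomp // u2.
    exact: field_nat.
exists v; split=> [|w [[ws wt] [w1 w2]]].
  split=> //; split.
  - by apply: field_faithful => //; rewrite whl_vcomp // vu u1.
  - by apply: field_faithful => //; rewrite whl_vcomp // vu u2.
apply: field_faithful => //; rewrite vu; apply: uU; split=> //.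
by rewrite -!whl_vcomp // w1 w2.
Qed.

(** * The tangent structure of a field object *)

Lemma field_T : exists T' : mor O O,
  J ∘ T' = T ∘ J /\ th ▷ T' = (c ▷ J) • (T ◁ th).
Proof.
have ths := field_object_src; have tht := field_object_tgt.
case: fo => _ sec lift _.
have [||T' [? _]] := lift O (T ∘ J) ((c ▷ J) • (T ◁ th)); last by exists T'.
  by [].
move=> hS; rewrite -vcompA // whr_comp1 -whr_vcomp // tpc whlr.
by rewrite -whl_vcomp // sec // whl_id2.
Qed.

Variable T' : mor O O.
Hypotheses (JT : J ∘ T' = T ∘ J) (thT : th ▷ T' = (c ▷ J) • (T ◁ th)).

Lemma field_TT : th ▷ (T' ∘ T') =
  ((c ▷ T) ▷ J) • (((T ◁ c) ▷ J) • (T ◁ (T ◁ th))).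
Proof.
have ths := field_object_src; have tht := field_object_tgt.
rewrite whr_comp1 thT whr_vcomp // -whr_comp1 JT whr_comp1; congr (_ • _).
by rewrite whlr thT whl_vcomp // whlr.
Qed.

(** Each of the next lifts checks that a structural 2-cell whiskered by [J]
    commutes with the fields: naturality moves it past [T th], and the
    remaining identity between 2-cells of [X] is an axiom on [c]. *)
Lemma field_p : exists p', from_to T' (id1 O) p' /\ J ◁ p' = p ▷ J.
Proof.
have ths := field_object_src; have tht := field_object_tgt.
apply: field_full; first by [].
rewrite whr_id1 thT -vcompA // -whlr -whr_vcomp // Tp_c -whr_comp1.
by rewrite (xchg (F := J) (H := id1 X)) // whl_id1.
Qed.

Lemma field_z : exists z', from_to (id1 O) T' z' /\ J ◁ z' = z ▷ J.
Proof.
have ths := field_object_src; have tht := field_object_tgt.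
apply: field_full; first by [].
rewrite whr_id1 thT vcompA // -(xchg (F' := T ∘ J) (G := id1 X)) // whl_id1.
rewrite whr_comp1 -vcompA // -whr_vcomp // -(tcz X) -vcompA // tcc vcomp_idl // whlr //.
Qed.

Lemma field_l : exists l', from_to T' (T' ∘ T') l' /\ J ◁ l' = l ▷ J.
Proof.
have ths := field_object_src; have tht := field_object_tgt.
apply: field_full; first by [].
rewrite thT field_TT !vcompA // -whl_comp1.
rewrite -(xchg (F' := T ∘ J) (G := T)) // -!vcompA //; congr (_ • _).
by rewrite whr_comp1 -!whr_vcomp // tccl whr_vcomp // whlr.
Qed.

Lemma field_c : exists c', from_to (T' ∘ T') (T' ∘ T') c' /\ J ◁ c' = c ▷ J.
Proof.
have ths := field_object_src; have tht := field_object_tgt.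
apply: field_full; first by [].
rewrite field_TT !vcompA // -whl_comp1.
rewrite -(xchg (F' := T ∘ J) (G := T ∘ T)) // -!vcompA //; congr (_ • _).
by rewrite whr_comp1 -whlr -!whr_vcomp // tYB.
Qed.

(** The field [tau] on [T_n ∘ J] is induced by the fields [th_T' • pi_k] on its
    components, as [T] preserves [T_n ∘ J]; the projections commute with the
    fields by construction.  The section equation for [tau] is tested against
    the projections of [T_n ∘ J] itself. *)
Lemma field_Tn n : exists P pr, 0 < n ->
  J ∘ P = Tn n ∘ J /\
  forall k, k < n -> from_to P T' (pr k) /\ J ◁ pr k = pi n k ▷ J.
Proof.
have ths := field_object_src; have tht := field_object_tgt.
(* for n = 0 nothing is required: T' and its identity are junk values *)
have [n0|n0] := posnP n; first by exists T', (fun=> id2 T'); rewrite n0.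
have [||tau [[[tas tat] tae] _]] := let: And3 _ _ univ := T_fibre_power X J n0 in
  univ (Tn n ∘ J) (fun k => (th ▷ T') • (pi n k ▷ J)).
- move=> k kn; have ? := tpi_src X kn; have ? := tpi_tgt X kn; by [].
- move=> j k jn kn; have ? := tpi_src X kn; have ? := tpi_tgt X kn.
  have ? := tpi_src X jn; have ? := tpi_tgt X jn.
  rewrite thT -!vcompA // -whlr -whr_vcomp // Tp_c -whr_comp1.
  rewrite (xchg (F := J) (H := id1 X)) // !vcompA // -!whr_vcomp //.
  by rewrite (tp_tpi X jn kn).
case: fo => _ sec lift _.
have [||P [[PJ Pth] _]] := lift O (Tn n ∘ J) tau; first by [].
  move=> hS.
  apply: (fibre_power_mono (whr_fibre_power X J n0) (A := Tn n ∘ J)) => // k kn.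
  have ? := tpi_src X kn; have ? := tpi_tgt X kn.
  rewrite -vcompA // whr_comp1 -whr_vcomp //.
  rewrite -{1}(whl_id1 (pi n k)) -(xchg (b := p) (G := T) (F' := T)) //.
  rewrite whr_vcomp // vcompA // whlr tae //.
  rewrite thT -vcompA // -vcompA // -whr_vcomp // tpc whlr -whl_vcomp //.
  by rewrite sec // whl_id2 vcomp_idl // vcomp_idr.
have ex k : exists q, k < n -> from_to P T' q /\ J ◁ q = pi n k ▷ J.
  have [kn|kn] := ltnP k n; last by exists (id2 T').
  have ? := tpi_src X kn; have ? := tpi_tgt X kn.
  have [||q qP] := @field_full O P T' (pi n k ▷ J); try by typed.
    by rewrite Pth tae.
  by exists q.
exists P, (fun k => proj1_sig (constructive_indefinite_description _ (ex k))).
move=> _; split=> // k kn.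
by case: constructive_indefinite_description => q /= /(_ kn).
Qed.

Variables (Tn2 : mor O O) (pr : nat -> cell O O).
Hypothesis JTn2 : J ∘ Tn2 = Tn 2 ∘ J.
Hypothesis prP : forall k, k < 2 ->
  from_to Tn2 T' (pr k) /\ J ◁ pr k = pi 2 k ▷ J.

(** With [u : T ∘ T_2 => T_2 ∘ T] induced by [c], the axiom
    [c • T s = s_T • u] gives [T s = c • s_T • u] as [c • c = id], and naturality of [s] reduces the claim to an equation
    of 2-cells into [T_2 ∘ T ∘ J], tested against the projections. *)
Lemma field_s : exists s', from_to Tn2 T' s' /\ J ◁ s' = s ▷ J.
Proof.
have ths := field_object_src; have tht := field_object_tgt.
apply: field_full; first by [].
have := lax_pair_spec (lax_T X); have := lax_s (lax_T X); rewrite /=.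
set u := pairing _ _ _ _ => eS [[usr utg] u0 u1].
have Ts : T ◁ s = c • (s ▷ T) • u.
  by rewrite vcompA // -eS -vcompA // tcc vcomp_idl.
have -> : (T ◁ (s ▷ J)) = (T ◁ s) ▷ J by rewrite whlr.
rewrite Ts thT !whr_vcomp // !vcompA //; congr (_ • _).
rewrite -(xchg (F' := T ∘ J) (G := Tn 2)) // whr_comp1; congr (_ • _).
apply: (fibre_power_mono (whr_fibre_power X (T ∘ J) (isT : 0 < 2))
          (A := Tn 2 ∘ J)) => //.
have aux k : k < 2 -> (pi 2 k ▷ T) • u = c • (T ◁ pi 2 k) ->
  (pi 2 k ▷ (T ∘ J)) • (Tn 2 ◁ th) = (pi 2 k ▷ (T ∘ J)) • ((u ▷ J) • (th ▷ Tn2)).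
  move=> k2 e; have ? := tpi_src X k2; have ? := tpi_tgt X k2.
  have [prft pre] := prP k2; have [? ?] := prft.
  rewrite (xchg (F := J) (H := T)) // whr_comp1 -[RHS]vcompA // -whr_vcomp // e.
  rewrite whr_vcomp // vcompA // whlr -pre -(field_nat prft) thT -!vcompA //.
  by rewrite -whr_vcomp // tcc whr_id2 vcomp_idl.
by case=> [|[|//]] _; apply: aux.
Qed.

End FieldObject.

(** A strict form of [lifts_along], which also carries the chosen [T_2] and its
    projections on the nose; the clause for [s] then needs no comparison. *)
Definition carries (K : two_category) (I X : K) (J : mor I X)
    (t' : tangent_structure I) (t : tangent_structure X) : Prop :=
  [/\ J ∘ tT t' = tT t ∘ J,
      J ∘ tTn t' 2 = tTn t 2 ∘ J,
      forall k, k < 2 -> J ◁ tpi t' 2 k = tpi t 2 k ▷ J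
    & [/\ J ◁ tp t' = tp t ▷ J, J ◁ tz t' = tz t ▷ J, J ◁ ts t' = ts t ▷ J,
          J ◁ tl t' = tl t ▷ J & J ◁ tc t' = tc t ▷ J]].

Section FieldStructure.
Variables (K : two_category) (X : tangentad K) (S : Prop) (O : K).
Variables (J : mor O X) (th : cell O X).
Hypothesis fo : is_field_object S J th.

Local Notation T := (tT X).
Local Notation p := (tp X).
Local Notation z := (tz X).
Local Notation s := (ts X).
Local Notation l := (tl X).
Local Notation c := (tc X).
Local Notation Tn := (tTn X).
Local Notation pi := (tpi X).

(** How [J] acts on the pairings occurring in the axioms: [pr] are the
    projections of a fibre power in [O] lying over the projections [pr0] of a
    pointwise fibre power in [X].  [J_pair], [J_Tpair] and [J_pairT] are its
    instances for [T_2], [T ∘ T_2] and [T_2 ∘ T]. *)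
Lemma field_pairing (q : cell O O) P pr (q0 : cell X X) P0 pr0 A' a' b' A a b :
  is_fibre_power 2 q P pr -> is_fibre_power 2 q0 P0 pr0 ->
  is_fibre_power 2 (q0 ▷ J) (P0 ∘ J) (fun k => pr0 k ▷ J) ->
  J ◁ q = q0 ▷ J -> J ∘ P = P0 ∘ J ->
  (forall k, k < 2 -> J ◁ pr k = pr0 k ▷ J) ->
  from_to A' (src q) a' -> from_to A' (src q) b' ->
  from_to A (src q0) a -> from_to A (src q0) b -> q0 • a = q0 • b ->
  J ◁ a' = a ▷ J -> J ◁ b' = b ▷ J ->
  [/\ from_to A' P (pairing (pr 0) (pr 1) a' b'),
      from_to A P0 (pairing (pr0 0) (pr0 1) a b)
    & J ◁ pairing (pr 0) (pr 1) a' b' = pairing (pr0 0) (pr0 1) a b ▷ J].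
Proof.
move=> pb pb0 pbJ Jq JP Jpr [a's a't] [b's b't] [as_ at_] [bs bt] e Ja Jb.
have JA : J ∘ A' = A ∘ J by rewrite -a's -as_ -src_whl -src_whr Ja.
have [|us u0 u1] := fibre_power_pair pb (conj a's a't) (conj b's b't).
  apply: (field_faithful fo) => //.
  by rewrite !whl_vcomp // Jq Ja Jb -!whr_vcomp // e.
have [ws w0 w1] := fibre_power_pair pb0 (conj as_ at_) (conj bs bt) e.
split=> //; move: us u0 u1 ws w0 w1.
set u := pairing _ _ _ _; set w := pairing _ _ _ _.
move=> [us ut] u0 u1 [ws wt] w0 w1.
apply: (fibre_power_mono pbJ (A := A ∘ J)) => //.
have aux k x y : k < 2 -> pr k • u = x -> pr0 k • w = y -> J ◁ x = y ▷ J ->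
    (pr0 k ▷ J) • (J ◁ u) = (pr0 k ▷ J) • (w ▷ J).
  move=> k2 <- <-; rewrite -(Jpr k k2).
  have [? ?] := fibre_power_ft pb k2; have [? ?] := fibre_power_ft pb0 k2.
  by rewrite whl_vcomp // whr_vcomp // Jpr.
by case=> [|[|k]] // _; [apply: aux u0 w0 Ja|apply: aux u1 w1 Jb].
Qed.

Variables (T' : mor O O) (Tn' : nat -> mor O O) (pr : nat -> nat -> cell O O).
Variables (p' z' s' l' c' : cell O O).
Hypotheses (JT : J ∘ T' = T ∘ J) (JTn : forall n, 0 < n -> J ∘ Tn' n = Tn n ∘ J).
Hypotheses (pr_src : forall n k, k < n -> src (pr n k) = Tn' n).
Hypotheses (pr_tgt : forall n k, k < n -> tgt (pr n k) = T').
Hypotheses (Jpr : forall n k, k < n -> J ◁ pr n k = pi n k ▷ J).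
Hypotheses (p_src : src p' = T') (p_tgt : tgt p' = id1 O) (Jp : J ◁ p' = p ▷ J).
Hypotheses (z_src : src z' = id1 O) (z_tgt : tgt z' = T') (Jz : J ◁ z' = z ▷ J).
Hypotheses (s_src : src s' = Tn' 2) (s_tgt : tgt s' = T') (Js : J ◁ s' = s ▷ J).
Hypotheses (l_src : src l' = T') (l_tgt : tgt l' = T' ∘ T') (Jl : J ◁ l' = l ▷ J).
Hypotheses (c_src : src c' = T' ∘ T') (c_tgt : tgt c' = T' ∘ T')
  (Jc : J ◁ c' = c ▷ J).

(** From here on, an equation of 2-cells of [O] is proved by computing both
    sides under [J], as whiskerings [b ▷ J] of the two sides of the same
    equation in [X]. *)
Lemma J_whlTw (Y : K) (a : cell Y O) : J ◁ (T' ◁ a) = T ◁ (J ◁ a).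
Proof. by rewrite -whl_comp1 JT whl_comp1. Qed.

Lemma J_whlT (a : cell O O) b : J ◁ a = b ▷ J -> J ◁ (T' ◁ a) = (T ◁ b) ▷ J.
Proof. by move=> e; rewrite J_whlTw e whlr. Qed.

Lemma J_whrT (a : cell O O) b : J ◁ a = b ▷ J -> J ◁ (a ▷ T') = (b ▷ T) ▷ J.
Proof. by move=> e; rewrite -whlr e -whr_comp1 JT whr_comp1. Qed.

Lemma J_vcomp (a' b' : cell O O) a b : J ◁ a' = a ▷ J -> J ◁ b' = b ▷ J ->
  tgt a' = src b' -> tgt a = src b -> J ◁ (b' • a') = (b • a) ▷ J.
Proof. by move=> ea eb t1 t2; rewrite whl_vcomp // ea eb whr_vcomp. Qed.

Lemma J_iter1 m : J ∘ iter1 T' m = iter1 T m ∘ J.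
Proof.
elim: m => [|m IH] /=; first by rewrite comp1id id1comp.
by rewrite -comp1A JT comp1A IH comp1A.
Qed.

(** The [T]-image of the [m]-th preservation statement in [X] is the [m.+1]-st
    one, so the family of all these statements is stable under the test of
    [creates_fibre_power]. *)
Lemma lifted_fibre_power (Y : K) (F : mor Y O) n m : 0 < n ->
  is_fibre_power n (iter1 T' m ◁ (p' ▷ F)) (iter1 T' m ∘ (Tn' n ∘ F))
    (fun k => iter1 T' m ◁ (pr n k ▷ F)).
Proof.
move=> n0; have E (a : cell Y O) : J ◁ (iter1 T' m ◁ a) = iter1 T m ◁ (J ◁ a).
  by rewrite -whl_comp1 J_iter1 whl_comp1.
have E' : J ∘ (iter1 T' m ∘ (Tn' n ∘ F)) = iter1 T m ∘ (Tn n ∘ (J ∘ F)).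
  by rewrite -comp1A J_iter1 comp1A -(comp1A J) JTn // comp1A.
apply: (creates_fibre_power fo).
- apply: eq_fibre_power (whl_fibre_power X m (J ∘ F) n0) => [||k kn].
  + by rewrite E -(whlr J) Jp whr_comp1.
  + by rewrite E'.
  + by rewrite E -(whlr J) Jpr // whr_comp1.
- apply: eq_fibre_power (whl_fibre_power X m.+1 (J ∘ F) n0) => [||k kn].
  + by rewrite E -(whlr J) Jp -whr_comp1 whl_comp1.
  + by rewrite E' comp1A.
  + by rewrite E -(whlr J) Jpr // -whr_comp1 whl_comp1.
- move=> k kn; have ? := pr_src kn; have ? := pr_tgt kn.
  by split; typed.
Qed.

Lemma lifted_preserved n m : 0 < n ->
  is_pointwise_fibre_power n (iter1 T' m ◁ p') (iter1 T' m ∘ Tn' n)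
    (fun k => iter1 T' m ◁ pr n k).
Proof.
move=> n0; split=> [|Y F].
- apply: eq_fibre_power (lifted_fibre_power (id1 O) m n0) => [||k _].
  + by rewrite whr_id1.
  + by rewrite comp1id.
  + by rewrite whr_id1.
- apply: eq_fibre_power (lifted_fibre_power F m n0) => [||k _].
  + by rewrite whlr.
  + by rewrite comp1A.
  + by rewrite whlr.
Qed.

Lemma lifted_pointwise n : 0 < n -> is_pointwise_fibre_power n p' (Tn' n) (pr n).
Proof.
move=> n0; have [h1 h2] := lifted_preserved 0 n0; split=> [|Y F].
- by apply: eq_fibre_power h1 => [||k _] /=; rewrite ?whl_id1 ?id1comp.
- by apply: eq_fibre_power (h2 Y F) => [||k _] /=; rewrite ?whl_id1 ?id1comp.
Qed.

Lemma J_pair (A' : mor O O) a' b' (A0 : mor X X) a b :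
  from_to A' T' a' -> from_to A' T' b' -> from_to A0 T a -> from_to A0 T b ->
  p • a = p • b -> J ◁ a' = a ▷ J -> J ◁ b' = b ▷ J ->
  [/\ from_to A' (Tn' 2) (pairing (pr 2 0) (pr 2 1) a' b'),
      from_to A0 (Tn 2) (pairing (pi 2 0) (pi 2 1) a b)
    & J ◁ pairing (pr 2 0) (pr 2 1) a' b' = pairing (pi 2 0) (pi 2 1) a b ▷ J].
Proof.
move=> a'P b'P aP bP e Ja Jb.
have [pb _] := lifted_pointwise (isT : 0 < 2).
have [pb0 pb0J] := tTn_pointwise X (isT : 0 < 2).
apply: (field_pairing pb pb0 (pb0J O J) Jp (JTn (isT : 0 < 2))
          (fun k => @Jpr 2 k) _ _ _ _ e Ja Jb);
 by rewrite ?p_src ?tp_src; eassumption.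
Qed.

Lemma J_Tpair (A' : mor O O) a' b' (A0 : mor X X) a b :
  from_to A' (T' ∘ T') a' -> from_to A' (T' ∘ T') b' ->
  from_to A0 (T ∘ T) a -> from_to A0 (T ∘ T) b ->
  (T ◁ p) • a = (T ◁ p) • b -> J ◁ a' = a ▷ J -> J ◁ b' = b ▷ J ->
  [/\ from_to A' (T' ∘ Tn' 2) (pairing (T' ◁ pr 2 0) (T' ◁ pr 2 1) a' b'),
      from_to A0 (T ∘ Tn 2) (pairing (T ◁ pi 2 0) (T ◁ pi 2 1) a b)
    & J ◁ pairing (T' ◁ pr 2 0) (T' ◁ pr 2 1) a' b' =
      pairing (T ◁ pi 2 0) (T ◁ pi 2 1) a b ▷ J].
Proof.
move=> a'P b'P aP bP e Ja Jb.
have [pb _] : is_pointwise_fibre_power 2 (T' ◁ p') (T' ∘ Tn' 2)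
  (fun k => T' ◁ pr 2 k).
  by have := lifted_preserved 1 (isT : 0 < 2); rewrite /= comp1id.
have [pb0 pb0J] : is_pointwise_fibre_power 2 (T ◁ p) (T ∘ Tn 2)
  (fun k => T ◁ pi 2 k).
  by have := tTn_preserved X 1 (isT : 0 < 2); rewrite /= comp1id.
have JTn2 := JTn (isT : 0 < 2).
apply: (field_pairing pb pb0 (pb0J O J) (J_whlT Jp) _ _ _ _ _ _ e Ja Jb) => //.
  by typed.
  by move=> k k2; apply: J_whlT; apply: Jpr.
all: by rewrite ?src_whl ?src_whr ?p_src ?tp_src; eassumption.
Qed.

Lemma J_pairT (A' : mor O O) a' b' (A0 : mor X X) a b :
  from_to A' (T' ∘ T') a' -> from_to A' (T' ∘ T') b' ->
  from_to A0 (T ∘ T) a -> from_to A0 (T ∘ T) b ->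
  (p ▷ T) • a = (p ▷ T) • b -> J ◁ a' = a ▷ J -> J ◁ b' = b ▷ J ->
  [/\ from_to A' (Tn' 2 ∘ T') (pairing (pr 2 0 ▷ T') (pr 2 1 ▷ T') a' b'),
      from_to A0 (Tn 2 ∘ T) (pairing (pi 2 0 ▷ T) (pi 2 1 ▷ T) a b)
    & J ◁ pairing (pr 2 0 ▷ T') (pr 2 1 ▷ T') a' b' =
      pairing (pi 2 0 ▷ T) (pi 2 1 ▷ T) a b ▷ J].
Proof.
move=> a'P b'P aP bP e Ja Jb.
have [_ /(_ O T') pb] := lifted_pointwise (isT : 0 < 2).
have pb0 := whr_fibre_power X T (isT : 0 < 2).
have JTn2 := JTn (isT : 0 < 2).
apply: (field_pairing pb pb0 _ (J_whrT Jp) _ _ _ _ _ _ e Ja Jb) => //.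
  apply: eq_fibre_power (whr_fibre_power X (T ∘ J) (isT : 0 < 2)) => [||k _];
  by rewrite ?comp1A // whr_comp1.
  by typed.
  by move=> k k2; apply: J_whrT; apply: Jpr.
all: by rewrite ?src_whl ?src_whr ?p_src ?tp_src; eassumption.
Qed.

Let pr20 : src (pr 2 0) = Tn' 2 := @pr_src 2 0 isT.
Let pr21 : src (pr 2 1) = Tn' 2 := @pr_src 2 1 isT.
Let pr30 : src (pr 3 0) = Tn' 3 := @pr_src 3 0 isT.
Let pr31 : src (pr 3 1) = Tn' 3 := @pr_src 3 1 isT.
Let pr32 : src (pr 3 2) = Tn' 3 := @pr_src 3 2 isT.
Let pr20t : tgt (pr 2 0) = T' := @pr_tgt 2 0 isT.
Let pr21t : tgt (pr 2 1) = T' := @pr_tgt 2 1 isT.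
Let pr30t : tgt (pr 3 0) = T' := @pr_tgt 3 0 isT.
Let pr31t : tgt (pr 3 1) = T' := @pr_tgt 3 1 isT.
Let pr32t : tgt (pr 3 2) = T' := @pr_tgt 3 2 isT.
Let J20 : J ◁ pr 2 0 = pi 2 0 ▷ J := @Jpr 2 0 isT.
Let J21 : J ◁ pr 2 1 = pi 2 1 ▷ J := @Jpr 2 1 isT.
Let J30 : J ◁ pr 3 0 = pi 3 0 ▷ J := @Jpr 3 0 isT.
Let J31 : J ◁ pr 3 1 = pi 3 1 ▷ J := @Jpr 3 1 isT.
Let J32 : J ◁ pr 3 2 = pi 3 2 ▷ J := @Jpr 3 2 isT.
Let e2 : p • pi 2 0 = p • pi 2 1 := tp_tpi X (isT : 0 < 2) (isT : 1 < 2).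

Lemma lifted_pz : p' • z' = id2 (id1 O).
Proof.
apply: (field_faithful fo) => //.
by rewrite (J_vcomp Jz Jp) // tpz whl_id2 whr_id2 comp1id id1comp.
Qed.

Lemma lifted_ps : p' • s' = p' • pr 2 0.
Proof.
apply: (field_faithful fo) => //.
by rewrite (J_vcomp Js Jp) // (J_vcomp J20 Jp) // tps.
Qed.

Lemma lifted_sA :
  s' • pairing (pr 2 0) (pr 2 1)
         (s' • pairing (pr 2 0) (pr 2 1) (pr 3 0) (pr 3 1)) (pr 3 2) =
  s' • pairing (pr 2 0) (pr 2 1)
         (pr 3 0) (s' • pairing (pr 2 0) (pr 2 1) (pr 3 1) (pr 3 2)).
Proof.
have e01 : p • pi 3 0 = p • pi 3 1 := tp_tpi X (isT : 0 < 3) (isT : 1 < 3).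
have e12 : p • pi 3 1 = p • pi 3 2 := tp_tpi X (isT : 1 < 3) (isT : 2 < 3).
have [pb _] := tTn_pointwise X (isT : 0 < 2).
have [||_ u00 u01] := fibre_power_pair (A := Tn 3) pb _ _ e01; try by typed.
have [||_ u10 u11] := fibre_power_pair (A := Tn 3) pb _ _ e12; try by typed.
have [||||[? ?] [? ?] E0] := J_pair (A' := Tn' 3) _ _ (A0 := Tn 3) _ _ e01 J30 J31;
  try by typed.
have [||||[? ?] [? ?] E1] := J_pair (A' := Tn' 3) _ _ (A0 := Tn 3) _ _ e12 J31 J32;
  try by typed.
have F0 := J_vcomp E0 Js ltac:(typed) ltac:(typed).
have F1 := J_vcomp E1 Js ltac:(typed) ltac:(typed).
have [|||||[? ?] [? ?] G0] := J_pair (A' := Tn' 3) _ _ (A0 := Tn 3) _ _ _ F0 J32;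
  try by typed.
  by rewrite -vcompA // tps vcompA // u00 e01.
have [|||||[? ?] [? ?] G1] := J_pair (A' := Tn' 3) _ _ (A0 := Tn 3) _ _ _ J30 F1;
  try by typed.
  by rewrite -vcompA // tps vcompA // u10 e01 e12.
apply: (field_faithful fo) => //.
by rewrite (J_vcomp G0 Js) // (J_vcomp G1 Js) // tsA.
Qed.

Lemma lifted_sC : s' • pairing (pr 2 0) (pr 2 1) (pr 2 1) (pr 2 0) = s'.
Proof.
have [||||[? ?] [? ?] E] := J_pair (A' := Tn' 2) _ _ (A0 := Tn 2) _ _ (esym e2)
  J21 J20; try by typed.
by apply: (field_faithful fo) => //; rewrite (J_vcomp E Js) // tsC Js.
Qed.

Lemma lifted_zs : s' • pairing (pr 2 0) (pr 2 1) (z' • p') (id2 T') = id2 T'.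
Proof.
have JI : J ◁ id2 T' = id2 T ▷ J by rewrite whl_id2 whr_id2 JT.
have [|||||[? ?] [? ?] E] := J_pair (A' := T') _ _ (A0 := T) _ _ _
  (J_vcomp Jp Jz ltac:(typed) ltac:(typed)) JI; try by typed.
  by rewrite -vcompA // tpz vcomp_idl // vcomp_idr.
by apply: (field_faithful fo) => //; rewrite (J_vcomp E Js) // tzs JI.
Qed.

Lemma lifted_pl : (T' ◁ p') • l' = z' • p'.
Proof.
apply: (field_faithful fo) => //.
by rewrite (J_vcomp Jl (J_whlT Jp)) // (J_vcomp Jp Jz) // tpl.
Qed.

Lemma lifted_lz : l' • z' = (T' ◁ z') • z'.
Proof.
apply: (field_faithful fo) => //.
by rewrite (J_vcomp Jz Jl) // (J_vcomp Jz (J_whlT Jz)) // tlz.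
Qed.

Lemma lifted_ls : l' • s' = (T' ◁ s') •
  pairing (T' ◁ pr 2 0) (T' ◁ pr 2 1) (l' • pr 2 0) (l' • pr 2 1).
Proof.
have [|||||[? ?] [? ?] E] := J_Tpair (A' := Tn' 2) _ _ (A0 := Tn 2) _ _ _
  (J_vcomp J20 Jl ltac:(typed) ltac:(typed))
  (J_vcomp J21 Jl ltac:(typed) ltac:(typed));
  try by typed.
  by rewrite -!vcompA // tpl !vcompA // e2.
have JTn2 := JTn (isT : 0 < 2).
apply: (field_faithful fo) => //.
by rewrite (J_vcomp Js Jl) // (J_vcomp E (J_whlT Js)) // tls.
Qed.

Lemma lifted_pc : (p' ▷ T') • c' = T' ◁ p'.
Proof.
apply: (field_faithful fo) => //.
by rewrite (J_vcomp Jc (J_whrT Jp)) // tpc (J_whlT Jp).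
Qed.

Lemma lifted_cz : c' • (T' ◁ z') = z' ▷ T'.
Proof.
apply: (field_faithful fo) => //.
by rewrite (J_vcomp (J_whlT Jz) Jc) // tcz (J_whrT Jz).
Qed.

Lemma lifted_cs : c' • (T' ◁ s') = (s' ▷ T') •
  pairing (pr 2 0 ▷ T') (pr 2 1 ▷ T') (c' • (T' ◁ pr 2 0)) (c' • (T' ◁ pr 2 1)).
Proof.
have [|||||[? ?] [? ?] E] := J_pairT (A' := T' ∘ Tn' 2) _ _ (A0 := T ∘ Tn 2) _ _ _
  (J_vcomp (J_whlT J20) Jc ltac:(typed) ltac:(typed))
  (J_vcomp (J_whlT J21) Jc ltac:(typed) ltac:(typed));
  try by typed.
  by rewrite -!vcompA // tpc -!whl_vcomp // e2.
have JTn2 := JTn (isT : 0 < 2).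
apply: (field_faithful fo) => //.
by rewrite (J_vcomp (J_whlT Js) Jc) // (J_vcomp E (J_whrT Js)) // tcs.
Qed.

Lemma lifted_ll : (T' ◁ l') • l' = (l' ▷ T') • l'.
Proof.
apply: (field_faithful fo) => //.
by rewrite (J_vcomp Jl (J_whlT Jl)) // (J_vcomp Jl (J_whrT Jl)) // tll.
Qed.

Lemma lifted_cl : c' • l' = l'.
Proof. by apply: (field_faithful fo) => //; rewrite (J_vcomp Jl Jc) // tcl. Qed.

Lemma lifted_ccl : (c' ▷ T') • (T' ◁ c') • (l' ▷ T') = (T' ◁ l') • c'.
Proof.
have cc := J_vcomp (J_whlT Jc) (J_whrT Jc) ltac:(typed) ltac:(typed).
apply: (field_faithful fo) => //.
by rewrite (J_vcomp (J_whrT Jl) cc) // (J_vcomp Jc (J_whlT Jl)) // tccl.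
Qed.

Lemma lifted_cc : c' • c' = id2 (T' ∘ T').
Proof.
apply: (field_faithful fo) => //.
by rewrite (J_vcomp Jc Jc) // tcc whl_id2 whr_id2 -comp1A JT !comp1A JT.
Qed.

Lemma lifted_YB : (T' ◁ c') • (c' ▷ T') • (T' ◁ c') =
  (c' ▷ T') • (T' ◁ c') • (c' ▷ T').
Proof.
have cc := J_vcomp (J_whlT Jc) (J_whrT Jc) ltac:(typed) ltac:(typed).
have cc' := J_vcomp (J_whrT Jc) (J_whlT Jc) ltac:(typed) ltac:(typed).
apply: (field_faithful fo) => //.
by rewrite (J_vcomp (J_whlT Jc) cc') // (J_vcomp (J_whrT Jc) cc) // tYB.
Qed.

Lemma lifted_lift : is_pointwise_pullback (Tn' 2) (T' ∘ T') (id1 O) T'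
  ((T' ◁ s') • pairing (T' ◁ pr 2 0) (T' ◁ pr 2 1)
                 (l' • pr 2 0) ((z' ▷ T') • pr 2 1))
  (p' • pr 2 0) (T' ◁ p') z'.
Proof.
have JTn2 := JTn (isT : 0 < 2).
have [||||[? ?] [? ?] E] := J_Tpair (A' := Tn' 2) _ _ (A0 := Tn 2) _ _
  (lift_cell_cone X)
  (J_vcomp J20 Jl ltac:(typed) ltac:(typed))
  (J_vcomp J21 (J_whrT Jz) ltac:(typed) ltac:(typed));
  try by typed.
have JV := J_vcomp E (J_whlT Js) ltac:(typed) ltac:(typed).
rewrite -/(lift_cell X) in JV; move: JV.
set V' := (T' ◁ s') • _ => JV.
have [Vs Vt] : from_to (Tn' 2) (T' ∘ T') V' by rewrite /V'; typed.
have [vs vt] := lift_cell_ft X.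
have J0 := J_vcomp J20 Jp ltac:(typed) ltac:(typed).
have main (Y : K) (F : mor Y O) :
    is_pullback (Tn' 2 ∘ F) (T' ∘ T' ∘ F) (id1 O ∘ F) (T' ∘ F)
      (V' ▷ F) ((p' • pr 2 0) ▷ F) ((T' ◁ p') ▷ F) (z' ▷ F).
  apply: (creates_pullback fo) => [||||| D u w]; try by typed.
  - have [_ /(_ Y (J ∘ F))] := tlift X; rewrite -/(lift_cell X).
    have -> : J ∘ (Tn' 2 ∘ F) = Tn 2 ∘ (J ∘ F) by typed.
    have -> : J ∘ (T' ∘ T' ∘ F) = T ∘ T ∘ (J ∘ F) by typed.
    have -> : J ∘ (id1 O ∘ F) = id1 X ∘ (J ∘ F) by typed.
    have -> : J ∘ (T' ∘ F) = T ∘ (J ∘ F) by typed.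
    by rewrite -!(whlr J) JV J0 (J_whlT Jp) Jz -!whr_comp1.
  - rewrite -!(whlr J) JV J0 -!whr_comp1 -(comp1A J) JTn2 comp1A.
    exact: T_lift_cell_mono.
split=> //; have := main O (id1 O).
by rewrite !comp1id !whr_id1.
Qed.

Definition lifted_structure : tangent_structure O :=
  TangentStructure (conj p_src p_tgt) (conj z_src z_tgt) (conj s_src s_tgt)
    (conj l_src l_tgt) (conj c_src c_tgt) lifted_pointwise lifted_preserved
    lifted_pz lifted_ps lifted_sA lifted_sC lifted_zs lifted_pl lifted_lz
    lifted_ls lifted_pc lifted_cz lifted_cs lifted_ll lifted_cl lifted_ccl
    lifted_cc lifted_YB lifted_lift.


End FieldStructure.

(** Choice is needed since the lifted fibre powers are obtained one [n] at a
    time. *)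
Theorem field_object_structure (K : two_category) (X : tangentad K) (S : Prop)
    (O : K) (J : mor O X) (th : cell O X) :
  is_field_object S J th -> exists t' : tangent_structure O,
    carries J t' X /\ th ▷ tT t' = (tc X ▷ J) • (tT X ◁ th).
Proof.
move=> fo; have [T' [JT thT]] := field_T fo.
have exTn n := field_Tn fo JT thT n.
pose Tn' n := proj1_sig (constructive_indefinite_description _ (exTn n)).
have exTn' n : exists pr, 0 < n -> J ∘ Tn' n = tTn X n ∘ J /\
  forall k, k < n -> from_to (Tn' n) T' (pr k) /\ J ◁ pr k = tpi X n k ▷ J.
  by rewrite /Tn'; case: constructive_indefinite_description.
pose pr n := proj1_sig (constructive_indefinite_description _ (exTn' n)).
have prP n : 0 < n -> J ∘ Tn' n = tTn X n ∘ J /\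
  forall k, k < n -> from_to (Tn' n) T' (pr n k) /\
                     J ◁ pr n k = tpi X n k ▷ J.
  by rewrite /pr; case: constructive_indefinite_description.
have JTn n : 0 < n -> J ∘ Tn' n = tTn X n ∘ J by case/prP.
have prk n k : k < n -> from_to (Tn' n) T' (pr n k) /\
                     J ◁ pr n k = tpi X n k ▷ J.
  by move=> kn; have [|_] := prP n; [apply: leq_ltn_trans kn|apply].
have pr_src n k : k < n -> src (pr n k) = Tn' n by case/prk => [[]].
have pr_tgt n k : k < n -> tgt (pr n k) = T' by case/prk => [[]].
have Jpr n k : k < n -> J ◁ pr n k = tpi X n k ▷ J by case/prk.
have [p' [[ps pt] Jp]] := field_p fo JT thT.
have [z' [[zs zt] Jz]] := field_z fo JT thT.
have [l' [[ls lt] Jl]] := field_l fo JT thT.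
have [c' [[cs ct] Jc]] := field_c fo JT thT.
have [s' [[ss st] Js]] := field_s fo JT thT (JTn 2 isT) (prk 2).
exists (lifted_structure fo JT JTn pr_src pr_tgt Jpr ps pt Jp zs zt Jz
          ss st Js ls lt Jl cs ct Jc).
by split=> //; split=> //=; [apply: JTn|move=> k; apply: Jpr].
Qed.

(** * Strict tangent morphisms *)

Section Strict.
Variable K : two_category.

Lemma carries_lifts (I X : K) (J : mor I X) t' t :
  carries J t' t -> lifts_along J t' t.
Proof.
case=> JT JTn2 Jpi [Jp Jz Js Jl Jc] Y; split=> [a|H].
  by rewrite -!whl_comp1 JT.
split; first by typed.
split; rewrite -?(whlr J) ?Jp ?Jz ?Jl ?Jc ?Js ?Jpi // -?whr_comp1 //.
rewrite (pairing_unique (u := id2 (tTn t 2 ∘ (J ∘ H)))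
  (whr_fibre_power t (J ∘ H) (isT : 0 < 2))) //.
- by rewrite vcomp_idr //; typed.
- by rewrite -!whr_vcomp // (tp_tpi t (isT : 0 < 2) (isT : 1 < 2)).
- by rewrite vcomp_idr.
- by rewrite vcomp_idr.
Qed.

Lemma strict_lax (A B : tangentad K) (J : mor A B) :
  lifts_along J A B -> is_lax_tangent J (id2 (J ∘ tT A)).
Proof.
move=> lft; have [Ja /(_ (id1 A))] := lft A.
rewrite !comp1id !whr_id1 => -[JT [Jp Jz Js Jl Jc]].
split; first by typed.
rewrite !vcomp_idl //; split.
- by rewrite Jp vcomp_idr.
- by rewrite Jz.
- by rewrite Js.
- by rewrite vcomp_idr // Jl whl_id2 whr_id2 !vcomp_idl.
- rewrite Jc whl_id2 whr_id2 !JT !comp1A JT.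
  by rewrite !vcomp_idl ?vcomp_idr //; typed.
Qed.

(** The axioms for [(G, d)] become those for [(U ∘ G, U d)] after applying [U].
    For [s], the chosen [T_2] of [B] and [C] are only compared through a pairing,
    and the two sides are matched by testing against the projections. *)
Lemma lax_reflect (A B C : tangentad K) (U : lax_tangent B C) (G : mor A B)
    (d : cell A B) :
  is_strict U ->
  (forall (a b : cell A B), src a = src b -> tgt a = tgt b ->
     U ◁ a = U ◁ b -> a = b) ->
  from_to (G ∘ tT A) (tT B ∘ G) d ->
  is_lax_tangent (U ∘ G) (U ◁ d) -> is_lax_tangent G d.
Proof.
case=> UT Uid faith [ds dt] [_ [Up Uz Us Ul Uc]].
have UTw (Y : K) (a : cell Y B) : U ◁ (tT B ◁ a) = tT C ◁ (U ◁ a).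
  by rewrite -!whl_comp1 UT.
have Pp : U ◁ tp B = tp C ▷ U by rewrite -lax_p Uid vcomp_idr.
have Pz : U ◁ tz B = tz C ▷ U by rewrite -lax_z Uid vcomp_idl.
have Pl : U ◁ tl B = tl C ▷ U.
  rewrite -[RHS](vcomp_idr (F := U ∘ tT B)) // -Uid lax_l Uid whl_id2 whr_id2.
  by rewrite [id2 _ • _]vcomp_idl ?vcomp_idl //; typed.
have Pc : U ◁ tc B = tc C ▷ U.
  have := lax_c U; rewrite Uid whl_id2 whr_id2 => E.
  rewrite -[LHS](vcomp_idl (F := tT C ∘ (U ∘ tT B))) //.
  rewrite vcompA // in E.
  have F : id2 (tT C ∘ (U ∘ tT B)) • id2 (U ∘ tT B ∘ tT B) =
           id2 (tT C ∘ (U ∘ tT B)) by rewrite vcomp_idr //; typed.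
  by rewrite F in E; rewrite -E vcomp_idr //; typed.
have [[us ut] u0 u1] := lax_pair_spec U.
have Ps := lax_s U; rewrite Uid vcomp_idl // in Ps.
rewrite !Uid !vcomp_idl // in us ut u0 u1 Ps.
have lp : (tp B ▷ G) • d = G ◁ tp A.
  by apply: faith => //; rewrite whl_vcomp // -whlr Pp -whr_comp1 Up whl_comp1.
split=> //; split=> //.
- by apply: faith => //; rewrite whl_vcomp // -whlr Pz -whr_comp1 -Uz whl_comp1.
- have cone : (tp B ▷ G) • (d • (G ◁ tpi A 2 0)) =
              (tp B ▷ G) • (d • (G ◁ tpi A 2 1)).
    by rewrite -!vcompA // lp -!whl_vcomp // tp_pi.
  have [||[qs qt] q0 q1] := fibre_power_pair (A := G ∘ tTn A 2)
    (whr_fibre_power B G (isT : 0 < 2)) _ _ cone; try by typed.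
  move: qs qt q0 q1; set q := pairing _ _ _ _ => qs qt q0 q1.
  move: us ut u0 u1 Ps; set u := pairing _ _ _ _ => us ut u0 u1 Ps.
  apply: faith => //.
  rewrite whl_vcomp // -whl_comp1 Us whl_vcomp // -whlr Ps whr_vcomp //.
  rewrite vcompA // -whr_comp1; congr (_ • _).
  apply: (pairing_unique (whr_fibre_power C (U ∘ G) (isT : 0 < 2))) => //.
  + by rewrite -!vcompA // Up -!whl_vcomp // tp_pi.
  + rewrite -vcompA // whr_comp1 -whr_vcomp // u0 whlr -whl_vcomp // q0.
    by rewrite whl_vcomp // whl_comp1.
  + rewrite -vcompA // whr_comp1 -whr_vcomp // u1 whlr -whl_vcomp // q1.
    by rewrite whl_vcomp // whl_comp1.
- apply: faith => //; rewrite !whl_vcomp // UTw -!whlr Pl -whr_comp1 Ul.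
  by rewrite whl_comp1.
- apply: faith => //; rewrite !whl_vcomp // UTw -!whlr Pc -whr_comp1 Uc.
  by rewrite whl_comp1.
Qed.

End Strict.

(** * Universality of the field *)

Section Universality.
Variable K : two_category.

Lemma inj_surj_bij (A B : Type) (f : A -> B) :
  injective f -> (forall y, exists x, f x = y) -> bijective f.
Proof.
move=> inj sur.
pose g y := proj1_sig (constructive_indefinite_description _ (sur y)).
have gK : cancel g f by move=> y; rewrite /g; case: constructive_indefinite_description.
by exists g => // x; apply: inj.
Qed.

Lemma lax_tangent_eq (A B : tangentad K) (F G : lax_tangent A B) :
  lmor F = lmor G -> lcell F = lcell G -> F = G.
Proof.
case: F G => [F al hF] [G be hG] /= e1 e2; case: _ / e1 hG => hG.
by case: _ / e2 hG => hG; rewrite (proof_irrelevance _ hF hG).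
Qed.

(** A vector field has a type depending on its base, but its underlying 2-cell
    does not; equality can thus be checked on untyped data. *)
Lemma tng_VF_eq (A B : tangentad K) (M N : tng_VF A B) :
  lmor (VF_base M) = lmor (VF_base N) ->
  lcell (VF_base M) = lcell (VF_base N) ->
  sval (sval (VF_field M)) = sval (sval (VF_field N)) -> M = N.
Proof.
case: M N => [M v] [N w] /= e1 e2; have e := lax_tangent_eq e1 e2.
case: _ / e w {e1 e2} => w e; congr VFOb.
by apply: sig_eq; apply: sig_eq.
Qed.

(** [G] comes from the universal property of the field object; the rest rests on
    the hypothesis [v_T = c_U • T v], by which the field of [T ∘ G] is the
    [c • T tau] that occurs in the tangency of [tau]. *)
Lemma field_object_universal (X V : tangentad K) (U : lax_tangent V X)
    (v : tng_vector_field U) :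
  is_field_object True U (field_cell v) ->
  is_strict U ->
  field_cell v ▷ tT V = (tc X ▷ U) • (tT X ◁ field_cell v) ->
  is_universal_vector_field v.
Proof.
move=> fo strU thT; split=> // A; have [UT Uid] := strU.
have ths := field_object_src fo; have tht := field_object_tgt fo.
have UTw (a : cell A V) : U ◁ (tT V ◁ a) = tT X ◁ (U ◁ a).
  by rewrite -!whl_comp1 UT.
have lcU (F : mor A V) (a : cell A V) : tgt a = tT V ∘ F ->
    (lcell U ▷ F) • (U ◁ a) = U ◁ a.
  by move=> at_; rewrite Uid whr_id2 vcomp_idl.
split=> [|F G].
- apply: inj_surj_bij => [F G e | M].
  + have eF : U ∘ lmor F = U ∘ lmor G.
      by apply: (congr1 (fun M : tng_VF A X => lmor (VF_base M)) e).
    have eth : field_cell v ▷ lmor F = field_cell v ▷ lmor G.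
      by apply: (congr1 (fun M : tng_VF A X => sval (sval (VF_field M))) e).
    have elc : U ◁ lcell F = U ◁ lcell G.
      have := congr1 (fun M : tng_VF A X => lcell (VF_base M)) e.
      by rewrite /= !lcU.
    have eFG := field_mor_inj fo eF eth.
    apply: lax_tangent_eq => //; apply: (field_faithful fo) => //;
      by rewrite ?lcell_src ?lcell_tgt eFG.
  + have [[taus taut] tauT] := svalP (sval (VF_field M)).
    have sec : (tp X ▷ lmor (VF_base M)) • sval (sval (VF_field M)) =
               id2 (lmor (VF_base M)).
      exact: (congr1 sval (svalP (VF_field M))).
    move: taus taut tauT sec; rewrite /=.
    set tau := sval (sval _); set H := VF_base M.
    move=> taus taut tauT sec.
    have := fo; case=> _ _ lift _.
    have [|G [[GH Gtau] _]] := lift A H tau (conj taus taut).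
      by [].
    (* tangency of tau, with c • c = id, is the lifting condition for gamma *)
    have Gft : from_to (U ∘ (G ∘ tT A)) (U ∘ (tT V ∘ G)) (lcell H).
      by split; typed.
    have [|d [[ds dt] dH]] := field_full fo Gft.
      rewrite whr_comp1 thT whr_vcomp // -whr_comp1 GH whlr Gtau.
      rewrite vcompA // tauT -!vcompA // -whr_vcomp // tcc whr_id2 vcomp_idl //.
      by rewrite whr_comp1 Gtau.
    have Glax : is_lax_tangent G d.
      apply: (lax_reflect strU) => //.
        exact: (field_faithful fo).
      by rewrite GH dH; apply: lax_ok.
    exists (LaxTangent Glax).
    by apply: tng_VF_eq => //=; rewrite lcU.
- apply: inj_surj_bij => [a b e|phi].
    apply: sig_eq; have [[as_ at_] _] := svalP a; have [[bs bt] _] := svalP b.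
    apply: (field_faithful fo); rewrite ?as_ ?bs ?at_ ?bt //.
    exact: (congr1 (fun u => sval (sval u)) e).
  have [[phis phit] phiT] := svalP (sval phi).
  have phiv := congr1 sval (svalP phi).
  move: phis phit phiT phiv; rewrite /= !lcU //.
  set ph := sval (sval phi) => phis phit phiT phiv.
  have [|a [[as_ at_] aph]] := field_full fo (conj phis phit).
    by rewrite phiv.
  have aT : is_tangent_cell F G a.
    split=> //; apply: (field_faithful fo) => //.
    rewrite !whl_vcomp // UTw aph phiT; congr (_ • _).
    by rewrite -(whlr U) aph.
  by exists (exist _ a aT); apply: sig_eq; apply: sig_eq.
Qed.

(** * The inserter and the equifier *)

Lemma inserter_field_object (X : tangentad K) (I : K) (V : mor I X) theta :
  is_inserter (id1 X) (tT X) V theta -> is_field_object False V theta.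
Proof.
case=> theta_ft iso; have [ths tht] := theta_ft; rewrite id1comp in ths.
split=> // [Y H tau [taus taut] _|Y G G' phi [phis phit] e].
- have [[g gK Kg] _] := iso Y.
  have tauft : from_to (id1 X ∘ H) (tT X ∘ H) tau by typed.
  exists (g (InsertOb tauft)); have := Kg (InsertOb tauft).
  move: (g _) => G e.
  have eH := congr1 (@ins_mor _ _ _ _ _ _) e.
  have et := congr1 (@ins_cell _ _ _ _ _ _) e.
  split=> // G' [e1 e2]; rewrite -(gK G) -(gK G'); congr g.
  rewrite e; clear - e1 e2.
  rewrite /= /insert_cmp_ob; move: (insert_cmp_ob_subproof _ _).
  rewrite /= e1 e2 => h; by rewrite (proof_irrelevance _ h tauft).
- have [_ /(_ G G') [g gK Kg]] := iso Y.
  have phift : from_to (V ∘ G) (V ∘ G') phi by [].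
  have phie : (theta ▷ G') • (id1 X ◁ phi) = (tT X ◁ phi) • (theta ▷ G).
    by rewrite whl_id1.
  pose f : hom (insert_cmp Y theta_ft G) (insert_cmp Y theta_ft G') :=
    exist _ (exist _ phi phift) phie.
  exists (sval (g f)); have [gs gt] := svalP (g f).
  have ge : V ◁ sval (g f) = phi := congr1 (fun u => sval (sval u)) (Kg f).
  split=> // b [bft be].
  rewrite -[b]/(sval (exist _ b bft : hom (G : hom_cat Y I) G')).
  rewrite -(gK (exist _ b bft)); congr (sval (g _)).
  by apply: sig_eq; apply: sig_eq; rewrite /= be.
Qed.

(** A lift [G0] to [I] of the pair [(H, tau)] satisfies
    [(p_V • theta)_G0 = p_H • tau], so the equifying condition on [G0] is the
    section equation for [tau]. *)
Lemma equifier_field_object (X : tangentad K) (I E : K) (V : mor I X) theta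
    (W : mor E I) :
  is_field_object False V theta ->
  is_equifier (vcomp (whr (tp X) V) theta) (id2 V) W ->
  is_field_object True (V ∘ W) (theta ▷ W).
Proof.
move=> fo [eW iso]; have ths := field_object_src fo; have tht := field_object_tgt fo.
split=> [|_|Y H tau [taus taut] /(_ Logic.I) sec|Y G G' phi [phis phit] e].
- by typed.
- by rewrite whr_comp1 -whr_vcomp // eW whr_id2.
- have [_ _ lift _] := fo.
  have [|G0 [[e1 e2] _]] := lift Y H tau (conj taus taut); first by [].
  have G0eq : ((tp X ▷ V) • theta) ▷ G0 = id2 V ▷ G0.
    by rewrite whr_vcomp // -whr_comp1 whr_id2 e1 e2.
  have [[g gK Kg] _] := iso Y.
  have := Kg (exist _ G0 G0eq); move: (g _) => G e.
  have eG : W ∘ G = G0 := congr1 sval e.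
  exists G; split=> [|G' [e1' e2']].
    by rewrite comp1A eG -whr_comp1 eG.
  rewrite -(gK G) -(gK G'); congr g; apply: sig_eq => /=.
  apply: (field_mor_inj fo).
    by rewrite eG e1 -e1' comp1A.
  by rewrite eG e2 -e2' whr_comp1.
- have [||b [bft be]] := @field_full _ _ _ _ _ _ fo Y (W ∘ G) (W ∘ G') phi.
  + by typed.
  + by rewrite !whr_comp1.
  have [_ /(_ G G') [g gK Kg]] := iso Y.
  pose f : hom (equif_cmp Y eW G) (equif_cmp Y eW G') := exist _ b bft.
  have gb : W ◁ sval (g f) = b := congr1 sval (Kg f).
  exists (sval (g f)); split=> [|d [dft de]].
    by split; [exact: svalP (g f)|rewrite whl_comp1 gb].
  rewrite -[d]/(sval (exist _ d dft : hom (G : hom_cat Y E) G')).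
  rewrite -(gK (exist _ d dft)); congr (sval (g _)).
  apply: sig_eq => /=; have [? ?] := dft; have [? ?] := bft.
  by apply: (field_faithful fo) => //; rewrite be -whl_comp1 de.
Qed.

End Universality.

Lemma strict_comp (K : two_category) (A B C : tangentad K)
    (G : lax_tangent B C) (F : lax_tangent A B) :
  is_strict G -> is_strict F -> is_strict (lax_comp G F).
Proof.
case=> GT Gid [FT Fid]; split=> /=; first by typed.
by rewrite Gid Fid whr_id2 whl_id2 vcomp_idl ?comp1A //; typed.
Qed.

(** Both structures lie over the same one on [X], so they agree after applying
    [V], and [V] is faithful.  Equality of 1-morphisms into [I] needs in
    addition that the induced fields agree; on [T_2] this is tested against the
    projections. *)
Lemma carries_equifier (K : two_category) (X : tangentad K) (I E : K)
    (V : mor I X) (theta : cell I X) (W : mor E I)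
    (tI : tangent_structure I) (tE : tangent_structure E) :
  is_field_object False V theta -> carries V tI X -> carries (V ∘ W) tE X ->
  theta ▷ tT tI = (tc X ▷ V) • (tT X ◁ theta) ->
  (theta ▷ W) ▷ tT tE = (tc X ▷ (V ∘ W)) • (tT X ◁ (theta ▷ W)) ->
  carries W tE tI.
Proof.
move=> fo cI cE thI thE.
have ths := field_object_src fo; have tht := field_object_tgt fo.
have faith := field_faithful fo.
have [VT VTn Vpi [Vp Vz Vs Vl Vc]] := cI.
have [JT JTn Jpi [Jp Jz Js Jl Jc]] := cE.
have thTT' : theta ▷ (W ∘ tT tE) = theta ▷ (tT tI ∘ W).
  by rewrite !whr_comp1 thI thE whr_vcomp // whr_comp1 whlr.
have WT : W ∘ tT tE = tT tI ∘ W.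
  by apply: (field_mor_inj fo) => //; rewrite -!comp1A JT VT comp1A.
have WTn : W ∘ tTn tE 2 = tTn tI 2 ∘ W.
  apply: (field_mor_inj fo); first by rewrite -!comp1A JTn VTn comp1A.
  have JTn' : V ∘ (W ∘ tTn tE 2) = tTn X 2 ∘ (V ∘ W) by rewrite -comp1A JTn.
  have JTn'' : V ∘ (tTn tI 2 ∘ W) = tTn X 2 ∘ (V ∘ W).
    by rewrite -comp1A VTn comp1A.
  apply: (fibre_power_mono (T_fibre_power X (V ∘ W) (isT : 0 < 2))
            (A := tTn X 2 ∘ (V ∘ W))) => // k k2.
  have ? := tpi_src tE k2; have ? := tpi_tgt tE k2.
  have ? := tpi_src tI k2; have ? := tpi_tgt tI k2.
  have eE : V ◁ (W ◁ tpi tE 2 k) = tpi X 2 k ▷ (V ∘ W).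
    by rewrite -whl_comp1 Jpi.
  have eI : V ◁ (tpi tI 2 k ▷ W) = tpi X 2 k ▷ (V ∘ W).
    by rewrite -whlr Vpi // whr_comp1.
  rewrite -{1}eE -(field_nat fo (G' := W ∘ tT tE)) //.
  by rewrite -eI -(field_nat fo (G' := tT tI ∘ W)) // eE eI thTT'.
have aux (a : cell E E) (b : cell I I) (d : cell X X) :
    V ∘ W ◁ a = d ▷ (V ∘ W) -> V ◁ b = d ▷ V -> V ◁ (W ◁ a) = V ◁ (b ▷ W).
  by move=> ea eb; rewrite -whl_comp1 ea -whlr eb whr_comp1.
split=> // [k k2|].
  have ? := tpi_src tE k2; have ? := tpi_tgt tE k2.
  have ? := tpi_src tI k2; have ? := tpi_tgt tI k2.
  by apply: faith => //; apply: aux (Jpi k k2) (Vpi k k2).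
split; apply: faith => //.
- exact: aux Jp Vp.
- exact: aux Jz Vz.
- exact: aux Js Vs.
- exact: aux Jl Vl.
- exact: aux Jc Vc.
Qed.

Theorem theorem4p8 (K : two_category) (X : tangentad K)
    (I : K) (V : mor I X) (theta : cell I X)
    (hI : is_inserter (id1 X) (tT X) V theta)
    (E : K) (W : mor E I)
    (hE : is_equifier (vcomp (whr (tp X) V) theta) (id2 V) W) :
  admits_vector_fields X /\
  (exists (tI : tangent_structure I) (tE : tangent_structure E),
      inserter_induced V theta tI X /\ equifier_induced W tE tI) /\
  (forall (tI : tangent_structure I) (tE : tangent_structure E),
      inserter_induced V theta tI X -> equifier_induced W tE tI ->
      exists (U : lax_tangent (Tangentad tE) X) (v : tng_vector_field U),
        lmor U = comp1 V W /\ field_cell v = whr theta W /\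
        is_universal_vector_field v).
Proof.
have foI := inserter_field_object hI.
have foE := equifier_field_object foI hE.
have ths := field_object_src foI; have tht := field_object_tgt foI.
have univ tI tE : inserter_induced V theta tI X -> equifier_induced W tE tI ->
    exists (U : lax_tangent (Tangentad tE) X) (v : tng_vector_field U),
      lmor U = comp1 V W /\ field_cell v = whr theta W /\
      is_universal_vector_field v.
  move=> [lV thV] lW.
  have strict (A B : tangentad K) (J : mor A B) (lJ : lifts_along J A B) :
      is_strict (LaxTangent (strict_lax lJ)).
    by have [_ /(_ (id1 A)) [/=]] := lJ A; rewrite !comp1id.
  pose U := lax_comp (LaxTangent (@strict_lax K (Tangentad tI) X V lV))
    (LaxTangent (@strict_lax K (Tangentad tE) (Tangentad tI) W lW)).
  have strU : is_strict U by apply: strict_comp; apply: strict.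
  have [UT Uid] := strU; rewrite [lmor U]/= in UT Uid.
  have WT : W ∘ tT tE = tT tI ∘ W.
    by have [_ /(_ (id1 E)) []] := lW E; rewrite !comp1id.
  have VT : V ∘ tT tI = tT X ∘ V.
    by have [_ /(_ (id1 I)) []] := lV I; rewrite !comp1id.
  have thT : (theta ▷ W) ▷ tT tE = (tc X ▷ (V ∘ W)) • (tT X ◁ (theta ▷ W)).
    by rewrite -whr_comp1 WT thV.
  have vP : is_tangent_cell U (homT (Tangentad tE) X U) (theta ▷ W).
    split; first by typed.
    have -> : lcell (homT (Tangentad tE) X U) =
              (tc X ▷ (V ∘ W)) • (tT X ◁ lcell U) by [].
    rewrite Uid whl_id2 ![_ • id2 _]vcomp_idr; try by rewrite /=; typed.
    by rewrite [X in _ = _ • X]thT -vcompA // -whr_vcomp // tcc whr_id2 vcomp_idl.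
  pose vc : @hom (tng_cat (Tangentad tE) X) U (homT (Tangentad tE) X U) :=
    exist _ (theta ▷ W) vP.
  have vs : compc (@homp K (Tangentad tE) X U) vc = idc (U : tng_cat _ _).
    by apply: sig_eq; case: foE => _ sec _ _; apply: sec.
  exists U, (exist _ vc vs); split=> //; split=> //.
  exact: field_object_universal.
have [tI [cI thI]] := field_object_structure foI.
have [tE [cE thE]] := field_object_structure foE.
have indI : inserter_induced V theta tI X.
  split=> [|Y H]; first exact: carries_lifts.
  by rewrite whr_comp1 thI whr_vcomp // -whr_comp1 whlr.
have indE : equifier_induced W tE tI.
  exact: carries_lifts (carries_equifier foI cI cE thI thE).
split; last by split=> //; exists tI, tE.
have [U [v [_ [_ univv]]]] := univ tI tE indI indE.
by exists (Tangentad tE), U, v.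
Qed.
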